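(* Let $d\in\mathbb{N}$ with $d\ge2$. Then there exists a non-rectifiable repetitive Delone set in $\mathbb{R}^d$ with a repetitivity function $R:(0,\infty)\to(0,\infty)$ such that $$R(r)\in\bigcap_{q>\frac{2}{d}} o\left(r\left(\frac{\log r}{\log\log r}\right)^q\right),$$ i.e. for every real $q>\frac2d$ one has $\lim_{r\to\infty} R(r)\Big/\left(r\left(\frac{\log r}{\log\log r}\right)^q\right)=0$.
   Context: $\mathbb{R}^d$ carries the Euclidean metric; $B(x,r)$ is the open Euclidean ball of radius $r>0$ centred at $x$. Delone set: a discrete set $X\subset\mathbb{R}^d$ such that (uniform discreteness) there is $r>0$ such that every ball of radius $r$ in $\mathbb{R}^d$ contains at most one point of $X$, and (relative density) there is $R>0$ such that every ball of radius $R$ in $\mathbb{R}^d$ contains at least one point of $X$. A Delone set $X\subset\mathbb{R}^d$ is non-rectifiable if there is no bi-Lipschitz bijection between $X$ and $\mathbb{Z}^d$ (a bijection $f$ is bi-Lipschitz if, for some $L>0$, both $f$ and $f^{-1}$ are $L$-Lipschitz with respect to the Euclidean metric). Repetitivity: for $x\in X$ and $r>0$ the $r$-patch centred at $x$ is $\mathcal{P}_{x,r}:=X\cap B(x,r)$. An $X$-translate of $\mathcal{P}_{x,r}$ is an $r$-patch $\mathcal{P}_{y,r}$ with $y\in X$ and $\mathcal{P}_{y,r}=y-x+\mathcal{P}_{x,r}$. Given a non-decreasing function $R:(0,\infty)\to(0,\infty)$, $X$ is $R(r)$-repetitive, and $R$ is called a repetitivity function of $X$, if for each $r>0$, each $x\in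 X$ and each $y\in\mathbb{R}^d$, an $X$-translate of $\mathcal{P}_{x,r}$ intersects $B(y,R(r))$. $X$ is repetitive if it has a repetitivity function. *)

(* Defs.v *)
From mathcomp Require Import all_boot all_order all_algebra.
From mathcomp Require Import all_classical all_reals all_analysis.
Set Implicit Arguments.
Unset Strict Implicit.
Unset Printing Implicit Defensive.
Import Order.TTheory GRing.Theory Num.Theory.
Import numFieldNormedType.Exports.
Local Open Scope classical_set_scope.
Local Open Scope ring_scope.

(* The library norm `|x| on 'rV[R]_d is the sup norm, hence the library [ball]
   and [k.-lipschitz_A] are not the Euclidean notions. *)
Definition enorm (R : realType) (d : nat) (x : 'rV[R]_d) : R :=
  Num.sqrt (\sum_(i < d) x 0 i ^+ 2).

Definition edist (R : realType) (d : nat) (x y : 'rV[R]_d) : R := enorm (x - y).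

Definition eball (R : realType) (d : nat) (x : 'rV[R]_d) (r : R) :
    set 'rV[R]_d :=
  [set y | edist x y < r].

Definition Zlattice (R : realType) (d : nat) : set 'rV[R]_d :=
  [set x | forall i : 'I_d, x 0 i \is a Num.int].

(* [isolated] refers to the product topology of 'rV[R]_d, which is the
   Euclidean one. *)
Definition discrete_set (R : realType) (d : nat) (X : set 'rV[R]_d) : Prop :=
  X `<=` isolated X.

Definition uniformly_discrete (R : realType) (d : nat) (X : set 'rV[R]_d) :
    Prop :=
  exists2 r : R, 0 < r & forall c : 'rV[R]_d, is_subset1 (X `&` eball c r).

Definition relatively_dense (R : realType) (d : nat) (X : set 'rV[R]_d) :
    Prop :=
  exists2 r : R, 0 < r & forall c : 'rV[R]_d, X `&` eball c r !=set0.

Definition Delone (R : realType) (d : nat) (X : set 'rV[R]_d) : Prop :=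
  [/\ discrete_set X, uniformly_discrete X & relatively_dense X].

Definition elipschitz_on (R : realType) (d : nat) (L : R) (A : set 'rV[R]_d)
    (f : 'rV[R]_d -> 'rV[R]_d) : Prop :=
  forall x y, A x -> A y -> edist (f x) (f y) <= L * edist x y.

(* Only the values of f on A and of g on B matter: f restricts to a bijection
   from A onto B, and g restricts to its inverse. *)
Definition bilipschitz_bijection (R : realType) (d : nat)
    (A B : set 'rV[R]_d) (f : 'rV[R]_d -> 'rV[R]_d) : Prop :=
  set_bij A B f /\
  exists g : 'rV[R]_d -> 'rV[R]_d, {in A, cancel f g} /\
    exists2 L : R, 0 < L & elipschitz_on L A f /\ elipschitz_on L B g.

Definition rectifiable (R : realType) (d : nat) (X : set 'rV[R]_d) : Prop :=
  exists f : 'rV[R]_d -> 'rV[R]_d, bilipschitz_bijection X (@Zlattice R d) f.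

Definition patch (R : realType) (d : nat) (X : set 'rV[R]_d) (x : 'rV[R]_d)
    (r : R) : set 'rV[R]_d :=
  X `&` eball x r.

(* The r-patch of X centred at y is an X-translate of the one centred at x. *)
Definition patch_translate (R : realType) (d : nat) (X : set 'rV[R]_d)
    (r : R) (x y : 'rV[R]_d) : Prop :=
  X y /\ patch X y r = [set (y - x) + p | p in patch X x r].

(* A function (0, oo) -> (0, oo) is encoded as a total function R -> R, of which
   only the values at positive arguments are constrained. *)
Definition repetitivity_function (R : realType) (d : nat) (X : set 'rV[R]_d)
    (rho : R -> R) : Prop :=
  [/\ (forall r, 0 < r -> 0 < rho r),
      (forall r s, 0 < r -> r <= s -> rho r <= rho s) &
      forall r (x y : 'rV[R]_d), 0 < r -> X x ->
        exists2 z, patch_translate X r x z &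
          patch X z r `&` eball y (rho r) !=set0].

Definition repetitive (R : realType) (d : nat) (X : set 'rV[R]_d) : Prop :=
  exists rho : R -> R, repetitivity_function X rho.

(* Main.v *)
(* The set is X = {p in Z^d | colour 0 p} for a hierarchical 2-colouring of Z^d:
   a cell of level k+1 is a block of n_k^d cells of level k, all of the same
   colour as the big cell, except for a dictionary, common to both colours, which
   lists all 2-coloured patterns of size m_k^d, where m_k tends slowly to infinity.

   Repetitivity: if l_k is the side of the cells of level k and r <= l_k / 2, a
   patch of radius r lies in a 2^d-block of cells of level k, and all such blocks
   occur in every cell of level k+1, so that R(r) = O(l_(k+1)).  For
   r > l_(k-1) / 2 this is O(r n_(k-1) n_k).  The dictionaries waste a proportion
   of about n_k^(-d) of the cells; this is summable, and the densities of the two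
   colours stay apart, as soon as n_k^d is k up to powers of log k.  Then
   n_(k-1) n_k is k^(2/d) up to powers of log k, and k = O(log r / log log r)
   since l_k is at least about (k!)^(1/d).

   Non-rectifiability is a discrete version of the Burago-Kleiner argument.  Let f
   be an L-bilipschitz bijection of X onto Z^d, and suppose that f stretches a
   segment of length N w by a factor A, along which N cubes of side w have
   alternately low and high density.  If no shorter segment parallel to it is
   stretched by more than (1 + k) A, then f is nearly a translation from some cube
   to the next one, and since f is onto Z^d with a Lipschitz inverse the two cubes
   have nearly the same number of points, which is absurd.  So some shorter
   segment is stretched by (1 + k) A.  Iterating this inside a self-similar pattern
   leads to a stretch larger than L; the pattern occurs in X because all patterns
   do. *)
Require Import Defs.
From mathcomp Require Import all_boot all_order all_algebra.
From mathcomp Require Import all_classical all_reals all_analysis.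
From mathcomp Require Import zify ring lra.
Import Order.TTheory GRing.Theory Num.Theory.
Import numFieldNormedType.Exports.
Local Open Scope ring_scope.
Set Implicit Arguments.
Unset Strict Implicit.
Unset Printing Implicit Defensive.

(** * Euclidean norm *)

Section EuclideanNorm.
Variables (R : realType) (d : nat).
Implicit Types x y : 'rV[R]_d.

Definition dotv x y : R := \sum_(i < d) x 0 i * y 0 i.

Lemma dotvDl x y z : dotv (x + y) z = dotv x z + dotv y z.
Proof.
by rewrite /dotv -big_split; apply: eq_bigr => i _; rewrite mxE mulrDl.
Qed.

Lemma dotvZl (a : R) x y : dotv (a *: x) y = a * dotv x y.
Proof.
by rewrite /dotv mulr_sumr; apply: eq_bigr => i _; rewrite mxE mulrA.
Qed.

Lemma dotvC x y : dotv x y = dotv y x.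
Proof. by apply: eq_bigr => i _; rewrite mulrC. Qed.

Lemma dotvNl x y : dotv (- x) y = - dotv x y.
Proof. by rewrite -scaleN1r dotvZl mulN1r. Qed.

Lemma dotv_sum (I : finType) (f : I -> 'rV[R]_d) y :
  dotv (\sum_i f i) y = \sum_i dotv (f i) y.
Proof.
apply: (big_morph (dotv^~ y)) => [a b|]; first exact: dotvDl.
by rewrite -(scale0r 0) dotvZl mul0r.
Qed.

Lemma dotvv_ge0 x : 0 <= dotv x x.
Proof. by apply: sumr_ge0 => i _; rewrite -expr2 sqr_ge0. Qed.

Lemma enorm_ge0 x : 0 <= enorm x.
Proof. exact: sqrtr_ge0. Qed.

Lemma enorm_sqr x : enorm x ^+ 2 = dotv x x.
Proof. by rewrite /enorm sqr_sqrtr //; apply: sumr_ge0 => i _; rewrite sqr_ge0. Qed.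

Lemma cauchy_schwarz x y : dotv x y <= enorm x * enorm y.
Proof.
have [/eqP x0|x0] := boolP (dotv x x == 0).
  have xE : x = 0.
    apply/rowP => i; apply/eqP; rewrite mxE -sqrf_eq0 expr2; apply/eqP.
    by apply: (psumr_eq0P _ x0) => // j _; rewrite -expr2 sqr_ge0.
  by rewrite xE -(scale0r x) dotvZl mul0r mulr_ge0 ?enorm_ge0.
have xp : 0 < dotv x x by rewrite lt_def x0 dotvv_ge0.
have h : dotv x y ^+ 2 <= dotv x x * dotv y y.
  have := dotvv_ge0 (dotv x x *: y - dotv x y *: x).
  rewrite !(dotvDl, dotvNl, dotvZl) !(dotvC _ (_ - _)) !(dotvDl, dotvNl, dotvZl).
  rewrite (dotvC y x) => h.
  have {}h : 0 <= dotv x x * (dotv x x * dotv y y - dotv x y ^+ 2).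
    by apply: le_trans h _; rewrite le_eqVlt; apply/orP; left; apply/eqP; ring.
  by rewrite -subr_ge0; rewrite pmulr_rge0 in h.
apply: le_trans (ler_norm _) _.
rewrite -(ler_pXn2r (n := 2)) ?nnegrE ?mulr_ge0 ?enorm_ge0 //.
by rewrite real_normK ?num_real // exprMn !enorm_sqr.
Qed.

Lemma enormD x y : enorm (x + y) <= enorm x + enorm y.
Proof.
rewrite -(ler_pXn2r (n := 2)) ?nnegrE ?addr_ge0 ?enorm_ge0 //.
rewrite sqrrD !enorm_sqr dotvDl !(dotvC _ (_ + _)) !dotvDl (dotvC y x).
have := cauchy_schwarz x y; lra.
Qed.

Lemma enormZ (a : R) x : enorm (a *: x) = `|a| * enorm x.
Proof.
apply/eqP; rewrite -(eqrXn2 (n := 2)) ?mulr_ge0 ?enorm_ge0 //.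
rewrite exprMn !enorm_sqr dotvZl dotvC dotvZl real_normK ?num_real //.
by rewrite expr2 mulrA.
Qed.

Lemma enormN x : enorm (- x) = enorm x.
Proof. by rewrite -scaleN1r enormZ normrN1 mul1r. Qed.

Lemma enorm0 : enorm (0 : 'rV[R]_d) = 0.
Proof. by rewrite -(scale0r 0) enormZ normr0 mul0r. Qed.

Lemma enormB x y : enorm (x - y) = enorm (y - x).
Proof. by rewrite -enormN opprB. Qed.

Lemma enorm_tri z x y : enorm (x - y) <= enorm (x - z) + enorm (z - y).
Proof. by apply: le_trans (enormD _ _); rewrite subrKA. Qed.

Lemma enorm_coord x i : `|x 0 i| <= enorm x.
Proof.
rewrite -sqrtr_sqr ler_wsqrtr // (bigD1 i) //= lerDl.
by apply: sumr_ge0 => j _; rewrite sqr_ge0.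
Qed.

Lemma enorm_le_coord x (B : R) : 0 <= B -> (forall i, `|x 0 i| <= B) ->
  enorm x <= d%:R * B.
Proof.
move=> B0 xB; rewrite -(ler_pXn2r (n := 2)) ?nnegrE ?enorm_ge0 ?mulr_ge0 //.
rewrite enorm_sqr; apply: (@le_trans _ _ (\sum_(i < d) B ^+ 2)).
  apply: ler_sum => i _; rewrite -expr2 -real_normK ?num_real //.
  by rewrite ler_pXn2r ?nnegrE.
rewrite sumr_const card_ord -[_ *+ d]mulr_natl exprMn; apply: ler_wpM2r; first exact: sqr_ge0.
by rewrite -natrX ler_nat; case: (d) => // n; rewrite expnS leq_pmulr // expn1.
Qed.

End EuclideanNorm.

(** * Boxes of integer points *)

Section Boxes.
Variable d : nat.
Implicit Types (o p q : 'rV[int]_d) (Y : pred 'rV[int]_d).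

(** The points of the box of side [w] at the origin are indexed by a finite type, so that counting
    them is taking a cardinal. *)
Definition bvec w (a : {ffun 'I_d -> 'I_w}) : 'rV[int]_d :=
  \row_i ((a i : nat)%:Z).

Definition inbox o (w : nat) p : bool :=
  [forall i, (o 0 i <= p 0 i) && (p 0 i < o 0 i + w%:Z)].

Definition cnt Y o w : nat :=
  #|[set a : {ffun 'I_d -> 'I_w} | Y (o + bvec a)]|.

Lemma mulvnE p n i : (p *+ n) 0 i = p 0 i * n%:Z.
Proof. by rewrite mulmxnE -mulr_natr natz. Qed.

Lemma bvec_inj w : injective (@bvec w).
Proof.
move=> a b /rowP ab; apply/ffunP => i; apply/val_inj.
by have := ab i; rewrite !mxE => -[].
Qed.

Lemma inboxP o w p : reflect (exists a, p = o + @bvec w a) (inbox o w p).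
Proof.
apply: (iffP forallP) => [h|[a ->] i]; last first.
  rewrite !mxE; case: (a i) => n /= hn; lia.
have hw i : (absz (p 0 i - o 0 i)%R < w)%N by have := h i; lia.
exists [ffun i => Ordinal (hw i)]; apply/rowP => i; rewrite !mxE ffunE /=.
have := h i; lia.
Qed.

Lemma inbox_bvec w (a : {ffun 'I_d -> 'I_w}) : inbox 0 w (bvec a).
Proof. by apply/inboxP; exists a; rewrite add0r. Qed.

Lemma inbox_add o w p q : inbox o w q = inbox (p + o) w (p + q).
Proof. by apply: eq_forallb => i; rewrite !mxE -addrA lerD2l ltrD2l. Qed.

Lemma card_box w : #|{ffun 'I_d -> 'I_w}| = (w ^ d)%N.
Proof. by rewrite card_ffun !card_ord. Qed.

(** Expand a product over the coordinates of sums over ['I_w], with the indicator of [Q] as weight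
    at [i] and weight 1 elsewhere. *)
Lemma card_box_coord w (Q : pred 'I_w) (i : 'I_d) :
  #|[set a : {ffun 'I_d -> 'I_w} | Q (a i)]| = (#|Q| * w ^ d.-1)%N.
Proof.
pose F j (k : 'I_w) : nat := if j == i then Q k : nat else 1%N.
have := @bigA_distr_bigA nat 0%N 1%N muln addn 'I_d 'I_w F.
rewrite (bigD1 i) //= => h; rewrite -sum1_card big_mkcond /=.
transitivity (\sum_(f : {ffun 'I_d -> 'I_w}) \prod_j F j (f j))%N.
  apply: eq_bigr => a _; rewrite inE (bigD1 i) //= big1 => [|j ji].
    by rewrite /F eqxx muln1; case: (Q _).
  by rewrite /F (negbTE ji).
rewrite -h; congr (_ * _)%N.
  rewrite -sum1_card [RHS]big_mkcond /=; apply: eq_bigr => k _.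
  by rewrite /F eqxx unfold_in; case: (Q k).
rewrite (eq_bigr (fun=> w)) => [|j ji]; last first.
  by rewrite /F (negbTE ji) sum1_card card_ord.
by rewrite prod_nat_const; congr (_ ^ _)%N; have := cardC1 i; rewrite card_ord.
Qed.

Lemma card_box_lt w h (i : 'I_d) :
  (#|[set a : {ffun 'I_d -> 'I_w} | (a i < h)%N]| <= h * w ^ d.-1)%N.
Proof.
rewrite (card_box_coord (fun k : 'I_w => k < h)%N) leq_mul2r; apply/orP; right.
rewrite cardE -(size_map val) -[leqRHS](size_iota 0).
apply: uniq_leq_size; first by rewrite map_inj_uniq ?enum_uniq //; apply: val_inj.
by move=> _ /mapP[k + ->]; rewrite mem_enum mem_iota.
Qed.

Lemma card_box_ge w h (i : 'I_d) :
  (#|[set a : {ffun 'I_d -> 'I_w} | (w <= a i + h)%N]| <= h * w ^ d.-1)%N.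
Proof.
apply: leq_trans (card_box_lt w h i).
pose f (a : {ffun 'I_d -> 'I_w}) := [ffun j => rev_ord (a j)].
have fi : injective f.
  move=> a b /ffunP ab; apply/ffunP => j.
  by have := ab j; rewrite !ffunE => /rev_ord_inj.
rewrite -(card_imset _ fi); apply: subset_leq_card; apply/fintype.subsetP => _ /imsetP[a + ->].
rewrite !inE ffunE /=; case: (a i) => n /= hn; lia.
Qed.

Lemma card_box_shell w h :
  (#|[set a : {ffun 'I_d -> 'I_w} | [exists i, (a i < h) || (w <= a i + h)]]|
    <= d * (2 * h * w ^ d.-1))%N.
Proof.
pose A (i : 'I_d) := [set a : {ffun 'I_d -> 'I_w} | (a i < h)%N || (w <= a i + h)%N].
have sA : [set a : {ffun 'I_d -> 'I_w} | [exists i, (a i < h) || (w <= a i + h)]]%N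
    \subset \bigcup_i A i.
  apply/fintype.subsetP => a; rewrite inE => /existsP[i hi].
  by apply/bigcupP; exists i; rewrite // inE.
apply: leq_trans (subset_leq_card sA) _.
apply: (@leq_trans (\sum_(i < d) #|A i|)%N).
  elim/big_rec2: _ => [|i n B _ hB]; first by rewrite cards0.
  by apply: leq_trans (leq_card_setU _ _) _; rewrite leq_add2l.
rewrite -[X in (_ <= X * _)%N](card_ord d) -sum_nat_const; apply: leq_sum => i _.
have -> : A i = [set a : {ffun 'I_d -> 'I_w} | (a i < h)%N]
    :|: [set a : {ffun 'I_d -> 'I_w} | (w <= a i + h)%N].
  by apply/setP => a; rewrite !inE.
apply: leq_trans (leq_card_setU _ _) _.
rewrite mul2n -addnn mulnDl; apply: leq_add; [exact: card_box_lt|exact: card_box_ge].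
Qed.

Lemma ltn_join m s (i : 'I_m) (j : 'I_s) : (i * s + j < m * s)%N.
Proof.
apply: (@leq_trans (i.+1 * s)); first by rewrite mulSn addnC ltn_add2r.
by rewrite leq_mul2r ltn_ord orbT.
Qed.

(** Base [s] digits in every coordinate: a cell of an [m]-grid together with a position inside that
    cell. *)
Definition bjoin m s (x : {ffun 'I_d -> 'I_m} * {ffun 'I_d -> 'I_s}) :
    {ffun 'I_d -> 'I_(m * s)} :=
  [ffun i => Ordinal (ltn_join (x.1 i) (x.2 i))].

Lemma bjoin_bij m s : bijective (@bjoin m s).
Proof.
apply: inj_card_bij; last by rewrite card_prod !card_box expnMn.
move=> [c a] [c' a'] /ffunP fe.
have h i : c i = c' i /\ a i = a' i.
  have := fe i; rewrite !ffunE => /(congr1 val) /= e.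
  have s0 : (0 < s)%N by apply: leq_ltn_trans (ltn_ord (a i)).
  split; apply/val_inj.
    by have := congr1 (divn^~ s) e; rewrite /= !divnMDl // !divn_small ?addn0.
  by have := congr1 (modn^~ s) e; rewrite /= !modnMDl !modn_small.
by congr pair; apply/ffunP => i; case: (h i).
Qed.

Lemma bvec_bjoin m s c a : bvec (@bjoin m s (c, a)) = bvec c *+ s + bvec a.
Proof.
by apply/rowP => i; rewrite [RHS]mxE mulvnE !mxE ffunE /= PoszD PoszM.
Qed.

Lemma cnt_split Y o m s :
  cnt Y o (m * s) = (\sum_(c : {ffun 'I_d -> 'I_m}) cnt Y (o + bvec c *+ s) s)%N.
Proof.
rewrite /cnt -sum1_card big_mkcond (reindex (@bjoin m s)) /=; last exact: onW_bij (bjoin_bij m s).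
rewrite -(pair_bigA _ (fun c a =>
  if bjoin (c, a) \in [set a | Y (o + bvec a)] then 1%N else 0%N)) /=.
apply: eq_bigr => c _; rewrite -sum1_card [RHS]big_mkcond /=.
by apply: eq_bigr => a _; rewrite !inE bvec_bjoin addrA.
Qed.

Lemma leq_cnt_inj (Y Y' : pred 'rV[int]_d) (phi : 'rV[int]_d -> 'rV[int]_d) o w o' w' :
  {in [pred x | inbox o w x && Y x] &, injective phi} ->
  (forall x, inbox o w x -> Y x -> inbox o' w' (phi x) && Y' (phi x)) ->
  (cnt Y o w <= cnt Y' o' w')%N.
Proof.
move=> phi_inj phiP.
have in_o (a : {ffun 'I_d -> 'I_w}) : inbox o w (o + bvec a).
  by apply/inboxP; exists a.
have ex (a : {ffun 'I_d -> 'I_w}) : Y (o + bvec a) ->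
    exists b : {ffun 'I_d -> 'I_w'}, phi (o + bvec a) = o' + bvec b.
  by move=> Ya; apply/inboxP; have /andP[] := phiP _ (in_o a) Ya.
(* The function [g] below needs a default value; an empty target box offers none, but then no point
   of the first box satisfies [Y]. *)
have [w'0|w'0] := posnP #|{ffun 'I_d -> 'I_w'}|.
  rewrite /cnt (_ : [set a : {ffun 'I_d -> 'I_w} | Y (o + bvec a)] = finset.set0) ?cards0 //.
  apply/setP => a; rewrite !inE; apply/negP => /ex[b _].
  by have := @max_card _ (pred1 b); rewrite card1 w'0.
have [b0 _] : exists b : {ffun 'I_d -> 'I_w'}, b \in predT by apply/card_gt0P.
pose g (a : {ffun 'I_d -> 'I_w}) : {ffun 'I_d -> 'I_w'} :=
  odflt b0 [pick b | phi (o + bvec a) == o' + bvec b].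
have gE a : Y (o + bvec a) -> phi (o + bvec a) = o' + bvec (g a).
  move=> Ya; rewrite /g; case: pickP => [b /eqP //|nb].
  by have [b /eqP hb] := ex a Ya; rewrite nb in hb.
rewrite /cnt -(card_in_imset (f := g)).
  apply: subset_leq_card; apply/fintype.subsetP => _ /imsetP[a + ->]; rewrite !inE => Ya.
  by rewrite -gE //; have /andP[] := phiP _ (in_o a) Ya.
move=> a a'; rewrite !inE => Ya Ya' gg; apply/bvec_inj/(addrI o)/phi_inj.
- by rewrite inE Ya andbT; apply/inboxP; exists a.
- by rewrite inE Ya' andbT; apply/inboxP; exists a'.
- by rewrite !gE // gg.
Qed.

End Boxes.

(** * Integer points and their Euclidean norm *)

Section IntegerPoints.
Variables (R : realType) (d : nat).
Implicit Types (p q : 'rV[int]_d).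

Definition ipt p : 'rV[R]_d := map_mx intr p.
Definition inrm p : R := enorm (ipt p).

Lemma iptE p i : ipt p 0 i = (p 0 i)%:~R.
Proof. by rewrite mxE. Qed.

Lemma iptD p q : ipt (p + q) = ipt p + ipt q.
Proof. by rewrite /ipt map_mxD. Qed.

Lemma iptN p : ipt (- p) = - ipt p.
Proof. by rewrite /ipt map_mxN. Qed.

Lemma iptB p q : ipt (p - q) = ipt p - ipt q.
Proof. by rewrite iptD iptN. Qed.

Lemma ipt0 : ipt 0 = 0.
Proof. by rewrite /ipt map_mx0. Qed.

Lemma iptMn p n : ipt (p *+ n) = n%:R *: ipt p.
Proof.
apply/rowP => i; rewrite !mxE mulvnE intrM mulrC; congr (_ * _).
Qed.

Lemma ipt_inj : injective ipt.
Proof.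
move=> p q /rowP pq; apply/rowP => i; have := pq i; rewrite !iptE.
exact: intr_inj.
Qed.

Lemma inrm_ge0 p : 0 <= inrm p.
Proof. exact: enorm_ge0. Qed.

Lemma inrm0 : inrm 0 = 0.
Proof. by rewrite /inrm ipt0 enorm0. Qed.

Lemma inrmD p q : inrm (p + q) <= inrm p + inrm q.
Proof. by rewrite /inrm iptD enormD. Qed.

Lemma inrmN p : inrm (- p) = inrm p.
Proof. by rewrite /inrm iptN enormN. Qed.

Lemma inrmB p q : inrm (p - q) = inrm (q - p).
Proof. by rewrite -inrmN opprB. Qed.

Lemma inrm_tri r p q : inrm (p - q) <= inrm (p - r) + inrm (r - q).
Proof. by apply: le_trans (inrmD _ _); rewrite subrKA. Qed.

Lemma inrmMn p n : inrm (p *+ n) = n%:R * inrm p.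
Proof. by rewrite /inrm iptMn enormZ normr_nat. Qed.

Lemma inrm_sum (I : finType) (f : I -> 'rV[int]_d) :
  inrm (\sum_i f i) <= \sum_i inrm (f i).
Proof.
elim/big_rec2: _ => [|i a b _ h]; first by rewrite inrm0.
by apply: le_trans (inrmD _ _) _; rewrite lerD2l.
Qed.

Lemma inrm_coord p i : `|p 0 i|%:~R <= inrm p.
Proof. by rewrite intr_norm -iptE enorm_coord. Qed.

Lemma inrm_le_coord p (B : nat) : (forall i, `|p 0 i| <= B%:Z) ->
  inrm p <= d%:R * B%:R.
Proof.
move=> pB; apply: enorm_le_coord => // i.
by rewrite iptE -intr_norm -[B%:R]/(B%:Z%:~R) ler_int.
Qed.

Lemma inrm_bvec w (a : {ffun 'I_d -> 'I_w}) : inrm (bvec a) <= d%:R * w%:R.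
Proof. by apply: inrm_le_coord => i; rewrite mxE; case: (a i) => n /= hn; lia. Qed.

Lemma inrm_delta i : inrm (delta_mx 0 i) = 1.
Proof.
rewrite /inrm /enorm (bigD1 i) //= big1 => [|j ji].
  by rewrite iptE mxE !eqxx expr1n addr0 sqrtr1.
by rewrite iptE mxE (negbTE ji) andbF expr0n.
Qed.

(* [x |-> G (F x + v)] injects the points of the first box at depth at least h
   into the second box. *)
Lemma leq_cnt_translation (L C E : R) (h w : nat) (Y : pred 'rV[int]_d)
    (F G : 'rV[int]_d -> 'rV[int]_d) (o u v : 'rV[int]_d) :
  0 <= L ->
  (forall q p, inrm (G q - p) <= L * inrm (q - F p) + C) ->
  (forall q, Y (G q)) -> injective G -> {in Y &, injective F} ->
  (forall x, inbox o w x -> inrm (F x + v - F (x + u)) <= E) ->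
  L * E + C <= h%:R ->
  (cnt Y o w <= cnt Y (o + u) w + d * (2 * h * w ^ d.-1))%N.
Proof.
move=> L0 hG YG Ginj Finj hE hh.
pose deep := [pred x : 'rV[int]_d |
  [forall i, (o 0 i + h%:Z <= x 0 i) && (x 0 i + h%:Z < o 0 i + w%:Z)]].
apply: (@leq_trans (cnt [pred x | Y x && deep x] o w + d * (2 * h * w ^ d.-1))%N).
  apply: leq_trans (leq_add (leqnn _) (card_box_shell d w h)).
  apply: leq_trans (leq_card_setU _ _); apply: subset_leq_card.
  apply/fintype.subsetP => a; rewrite !inE => -> /=.
  case: existsP => [|na]; first by rewrite orbT.
  rewrite orbF; apply/forallP => i; rewrite !mxE.
  have : ~~ ((a i < h) || (w <= a i + h))%N by apply/negP => ai; apply: na; exists i.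
  by case: (a i) => n /= _; lia.
rewrite leq_add2r; apply: (@leq_cnt_inj _ _ _ (fun x => G (F x + v))).
  move=> x y; rewrite !inE => /andP[_ /andP[Yx _]] /andP[_ /andP[Yy _]].
  by move=> /Ginj /addIr /Finj; apply.
move=> x xo /andP[Yx /forallP dx]; rewrite YG andbT; apply/forallP => i.
have : inrm (G (F x + v) - (x + u)) <= h%:R.
  apply: le_trans (hG _ _) _; apply: le_trans hh.
  by rewrite lerD2r ler_wpM2l // hE.
move=> /(le_trans (inrm_coord _ i)).
rewrite -[h%:R]/(h%:Z%:~R) ler_int !mxE => hi.
move: (dx i) hi; move: (x 0 i) (u 0 i) (o 0 i) (G _ 0 i) => a b c e; lia.
Qed.

End IntegerPoints.

(** * Stretching along a checkerboard *)

Section Alignment.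
Variables (R : realType) (d : nat).

Lemma ler_sum_exists (I : finType) (f : I -> R) (c : R) :
  (0 < #|I|)%N -> \sum_i f i <= #|I|%:R * c -> exists i, f i <= c.
Proof.
move=> I0 sf; apply: contrapT => nf.
have fc i : c < f i by rewrite ltNge; apply/negP => fi; apply: nf; exists i.
move: sf; apply/negP; rewrite -ltNge mulr_natl -sumr_const.
have [i _] : exists i : I, i \in predT by apply/card_gt0P.
rewrite (bigD1 i) // [ltRHS](bigD1 i) //=; apply: ltr_leD => //.
by apply: ler_sum => j _; apply: ltW.
Qed.

(* Steps that are nowhere much longer than the average D / N, but whose sum is
   close to D, must on average be aligned with D. *)
Lemma aligned_step (I : finType) (N : nat) (V : I -> 'I_N -> 'rV[R]_d)
    (D : 'rV[R]_d) (k : R) :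
  (0 < N)%N -> 0 <= k <= 1 ->
  (forall b, (1 - k) * enorm D ^+ 2 <= dotv (\sum_i V b i) D) ->
  (forall b i, N%:R * enorm (V b i) <= (1 + k) * enorm D) ->
  exists i, forall b,
    enorm (V b i - N%:R^-1 *: D) ^+ 2 <= 5 * k * #|I|%:R * (enorm D / N%:R) ^+ 2.
Proof.
move=> N0 /andP[k0 k1] hsum hV.
have Np : 0 < N%:R :> R by rewrite ltr0n.
(* The defect of alignment. It is nonnegative by Cauchy-Schwarz and, for each [b], its sum over [i]
   is at most 2 k |D|^2; averaging over [i] gives one index at which the defects of all [b] are
   small together. *)
pose def b i := (1 + k) * enorm D ^+ 2 / N%:R - dotv (V b i) D.
have def0 b i : 0 <= def b i.
  rewrite subr_ge0; apply: le_trans (cauchy_schwarz _ _) _.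
  rewrite ler_pdivlMr // mulrC mulrA expr2 mulrA.
  by apply: ler_wpM2r; [exact: enorm_ge0|exact: hV].
have [i hi] : exists i : 'I_N, \sum_b def b i <= #|I|%:R * (2 * k * enorm D ^+ 2 / N%:R).
  apply: ler_sum_exists; first by rewrite card_ord.
  rewrite exchange_big card_ord /=.
  apply: (@le_trans _ _ (\sum_(b : I) (2 * k * enorm D ^+ 2))); last first.
    rewrite sumr_const -[_ *+ #|_|]mulr_natl le_eqVlt; apply/orP; left; apply/eqP.
    by field; rewrite gt_eqF.
  apply: ler_sum => b _; rewrite /def sumrB -dotv_sum sumr_const card_ord -[_ *+ N]mulr_natl.
  rewrite [N%:R * _]mulrC divfK ?gt_eqF //.
  have := hsum b; lra.
exists i => b.
have hb : def b i <= #|I|%:R * (2 * k * enorm D ^+ 2 / N%:R).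
  apply: le_trans hi; rewrite (bigD1 b) //= lerDl.
  by apply: sumr_ge0 => j _.
have I1 : 1 <= #|I|%:R :> R by rewrite ler1n; apply/card_gt0P; exists b.
set B : R := #|I|%:R in hb I1 *.
rewrite enorm_sqr !(dotvDl, dotvNl, dotvZl) !(dotvC _ (_ - _)) !(dotvDl, dotvNl, dotvZl).
rewrite (dotvC D) -!enorm_sqr; set z := enorm D / N%:R.
have hv : enorm (V b i) ^+ 2 <= ((1 + k) * z) ^+ 2.
  rewrite ler_pXn2r ?nnegrE ?mulr_ge0 ?enorm_ge0 ?invr_ge0 ?ler0n ?addr_ge0 //.
  by rewrite /z mulrA ler_pdivlMr // mulrC.
move: hb; rewrite /def.
have -> : (1 + k) * enorm D ^+ 2 / N%:R = N%:R * ((1 + k) * z ^+ 2).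
  by rewrite /z; field; rewrite gt_eqF.
have -> : 2 * k * enorm D ^+ 2 / N%:R = N%:R * (2 * k * z ^+ 2).
  by rewrite /z; field; rewrite gt_eqF.
pose y := N%:R^-1 * dotv (V b i) D.
have -> : dotv (V b i) D = N%:R * y by rewrite /y mulVKf ?gt_eqF.
have -> : N%:R^-1 * enorm D ^+ 2 = N%:R * z ^+ 2 by rewrite /z; field; rewrite gt_eqF.
rewrite -!mulrBr !mulKf ?gt_eqF // [B * _]mulrCA ler_pM2l // => hy.
(* Expanding the square gives at most k^2 z^2 + 4 k B z^2, and k <= 1 <= B turns this into the
   constant 5. *)
have kk : k ^+ 2 * z ^+ 2 <= k * B * z ^+ 2.
  by apply: ler_wpM2r; [exact: sqr_ge0|rewrite expr2; nra].
rewrite exprMn in hv; lra.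
Qed.

End Alignment.

Section Checkerboard.
Variables (R : realType) (d : nat) (i0 : 'I_d).
Local Notation P := 'rV[int]_d.
Local Notation e := (delta_mx 0 i0 : P).

(* F extends the bijection from Y onto the integer points to all integer points,
   by means of a nearby point of Y, and G is its inverse. *)
Definition coarse_bilipschitz (L C : R) (Y : pred P) (F G : P -> P) : Prop :=
  [/\ forall p q, inrm R (F p - F q) <= L * inrm R (p - q) + C,
      forall q p, inrm R (G q - p) <= L * inrm R (q - F p) + C,
      forall q, Y (G q), injective G & {in Y &, injective F}].

Lemma inbox_split o m s (x : P) : inbox o (m * s) x ->
  exists b : {ffun 'I_d -> 'I_m}, inbox (o + bvec b *+ s) s x.
Proof.
move=> /inboxP[a ->].
have hb i : (a i %/ s < m)%N.
  case: (a i) => n /= hn; rewrite ltn_divLR //; lia.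
exists [ffun i => Ordinal (hb i)]; apply/forallP => i.
have -> : (o + bvec [ffun i => Ordinal (hb i)] *+ s) 0 i = o 0 i + ((a i %/ s)%N * s)%N%:Z.
  by rewrite mxE mulvnE !mxE ffunE /= PoszM.
rewrite !mxE -addrA lerD2l ltrD2l.
case: (a i) => n /= hn; have s0 : (0 < s)%N by lia.
have := divn_eq n s; have := ltn_pmod n s0; lia.
Qed.

Variables (L C : R) (Y : pred P) (F G : P -> P).
Hypotheses (L1 : 1 <= L) (FG : coarse_bilipschitz L C Y F G).

Let L0 : 0 <= L. Proof. by apply: le_trans L1. Qed.

(** Consider the rows of [N] cubes that start at the mu^d points of step [s] in the first cube.
    Shifting the start moves both ends of the image by little, so each row has displacement close to
    [D], and [aligned_step] gives a cube at which every row advances by about D / N. Passing from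
    the grid to any point of that cube costs two Lipschitz errors at scale [s]. *)
Lemma checkerboard_alignment (o : P) (N mu s : nat) (k eps : R) :
  let w := (mu * s)%N in
  let D := F (o + e *+ (N * w)) - F o in
  (0 < N)%N -> 0 <= k <= 1 -> 0 <= eps ->
  2 * (L * (d%:R * w%:R) + C) <= k * inrm R D ->
  inrm R D <= 2 * L * (N%:R * w%:R) ->
  5 * k * (mu ^ d)%:R * (2 * L) ^+ 2 <= eps ^+ 2 ->
  (forall (b : {ffun 'I_d -> 'I_mu}) (i : 'I_N),
     N%:R * inrm R (F (o + bvec b *+ s + e *+ (i.+1 * w))
                    - F (o + bvec b *+ s + e *+ (i * w))) <= (1 + k) * inrm R D) ->
  exists (i : 'I_N) (v : P), forall x, inbox (o + e *+ (i * w)) w x ->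
    inrm R (F (x + e *+ w) - F x - v)
      <= eps * w%:R + 2 * (L * (d%:R * s%:R) + C) + d%:R.
Proof.
move=> w D N0 k01 eps0 near Dle epsk hV.
have [hF _ _ _ _] := FG.
have Np : 0 < N%:R :> R by rewrite ltr0n.
pose V (b : {ffun 'I_d -> 'I_mu}) (i : 'I_N) : 'rV[R]_d :=
  ipt R (F (o + bvec b *+ s + e *+ (i.+1 * w)) - F (o + bvec b *+ s + e *+ (i * w))).
have [|i hi] := @aligned_step R d _ N V (ipt R D) k N0 k01 _ hV.
  move=> b.
  have -> : \sum_i V b i = ipt R (F (o + bvec b *+ s + e *+ (N * w)) - F (o + bvec b *+ s)).
    pose f j := ipt R (F (o + bvec b *+ s + e *+ (j * w))).
    transitivity (\sum_(0 <= j < N) (f j.+1 - f j)).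
      by rewrite big_mkord; apply: eq_bigr => j _; rewrite /V iptB.
    by rewrite telescope_sumr // iptB /f mul0n mulr0n addr0.
  set x1 := F (_ + _ *+ _ + _); set x0 := F (_ + _ *+ _).
  have bs : inrm R (bvec b *+ s) <= d%:R * w%:R.
    rewrite inrmMn /w natrM mulrCA [leRHS]mulrC [leRHS]mulrC.
    by rewrite mulrA [leRHS]mulrC ler_wpM2l // mulrC inrm_bvec.
  pose err := (F (o + e *+ (N * w)) - x1) + (x0 - F o).
  have errle : inrm R err <= k * inrm R D.
    apply: le_trans near; rewrite mulr2n mulrDl !mul1r.
    apply: le_trans (inrmD _ _ _) _; apply: lerD.
      apply: le_trans (hF _ _) _; rewrite lerD2r ler_wpM2l //.
      by rewrite inrmB [X in X - _]addrAC [X in X - _]addrC addrK.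
    apply: le_trans (hF _ _) _; rewrite lerD2r ler_wpM2l //.
    by rewrite [X in X - _]addrC addrK.
  have -> : ipt R (x1 - x0) = ipt R D - ipt R err.
    by rewrite -iptB; congr ipt; apply/rowP => j; rewrite /err /D !mxE; ring.
  rewrite dotvDl dotvNl -enorm_sqr mulrBl mul1r lerD2l lerN2.
  apply: le_trans (cauchy_schwarz _ _) _.
  by rewrite expr2 mulrA ler_wpM2r ?enorm_ge0.
(* The translation must be an integer vector, so D / N is rounded down; this is the error [d] in the
   conclusion. *)
pose v : P := \row_j divz (D 0 j) N%:Z.
exists i, v => x xin.
have hv : enorm (N%:R^-1 *: ipt R D - ipt R v) <= d%:R.
  rewrite -[leRHS]mulr1; apply: enorm_le_coord => // j.
  have -> : (N%:R^-1 *: ipt R D - ipt R v) 0 j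
      = (D 0 j)%:~R / N%:R - (divz (D 0 j) N%:Z)%:~R by rewrite !mxE mulrC.
  have h1 : (divz (D 0 j) N%:Z)%:~R * N%:R <= (D 0 j)%:~R :> R.
    by rewrite -[N%:R]/(N%:Z%:~R) -intrM ler_int lez_floor // gt_eqF // ltz_nat.
  have h2 : (D 0 j)%:~R <= ((divz (D 0 j) N%:Z)%:~R + 1) * N%:R :> R.
    by rewrite -[N%:R]/(N%:Z%:~R) -(intrD _ _ 1) -intrM ler_int ltW // ltz_ceil // ltz_nat.
  rewrite ger0_norm; last by rewrite subr_ge0 ler_pdivlMr.
  by rewrite lerBlDl ler_pdivrMr.
have [b xb] := inbox_split xin.
set y := (_ + _) in xb.
have hyx : inrm R (x - y) <= d%:R * s%:R.
  have /inboxP[r ->] := xb; rewrite [X in X - _]addrC addrK; exact: inrm_bvec.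
have yE : y = o + bvec b *+ s + e *+ (i * w) by rewrite /y addrAC.
have yE' : y + e *+ w = o + bvec b *+ s + e *+ (i.+1 * w).
  by rewrite yE -addrA -mulrnDr mulSnr.
have hb : enorm (ipt R (F (y + e *+ w) - F y) - N%:R^-1 *: ipt R D) <= eps * w%:R.
  rewrite -(ler_pXn2r (n := 2)) ?nnegrE ?enorm_ge0 ?mulr_ge0 //.
  rewrite yE' yE; apply: le_trans (hi b) _.
  have z1 : (enorm (ipt R D) / N%:R) ^+ 2 <= (2 * L * w%:R) ^+ 2.
    rewrite ler_pXn2r ?nnegrE ?divr_ge0 ?enorm_ge0 ?mulr_ge0 //.
    by rewrite ler_pdivrMr //; apply: le_trans Dle _; rewrite [N%:R * _]mulrC mulrA.
  have z0 : 0 <= 5 * k * (mu ^ d)%:R by case/andP: k01 => k0 _; rewrite !mulr_ge0.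
  rewrite card_box; apply: le_trans (ler_wpM2l z0 z1) _.
  by rewrite !exprMn -exprMn mulrA; apply: ler_wpM2r; first exact: sqr_ge0.
apply: le_trans (_ : inrm R (F (x + e *+ w) - F (y + e *+ w)) + inrm R (F y - F x)
   + (enorm (ipt R (F (y + e *+ w) - F y) - N%:R^-1 *: ipt R D)
      + enorm (N%:R^-1 *: ipt R D - ipt R v)) <= _).
  have -> : F (x + e *+ w) - F x - v = (F (x + e *+ w) - F (y + e *+ w) + (F y - F x))
      + (F (y + e *+ w) - F y - v) by apply/rowP => j; rewrite !mxE; ring.
  apply: le_trans (inrmD _ _ _) _; apply: lerD; first exact: inrmD.
  by apply: le_trans (enormD _ _); rewrite subrKA /inrm iptB.
have hx1 : inrm R (F (x + e *+ w) - F (y + e *+ w)) <= L * (d%:R * s%:R) + C.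
  apply: le_trans (hF _ _) _; rewrite lerD2r ler_wpM2l //.
  by rewrite opprD addrACA subrr addr0.
have hx2 : inrm R (F y - F x) <= L * (d%:R * s%:R) + C.
  apply: le_trans (hF _ _) _; rewrite lerD2r ler_wpM2l //.
  by rewrite inrmB.
lra.
Qed.


(** Where [F] nearly commutes with the translation, [leq_cnt_translation] applies in both
    directions, with [v] and with [- v]; [delta] bounds the points too near to the faces. *)
Lemma checkerboard_counts (o : P) (N mu s h : nat) (k eps : R) :
  let w := (mu * s)%N in
  let D := F (o + e *+ (N * w)) - F o in
  let S (i : nat) := cnt Y (o + e *+ (i * w)) w in
  let delta := (d * (2 * h * w ^ d.-1))%N in
  (0 < N)%N -> 0 <= k <= 1 -> 0 <= eps ->
  2 * (L * (d%:R * w%:R) + C) <= k * inrm R D ->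
  inrm R D <= 2 * L * (N%:R * w%:R) ->
  5 * k * (mu ^ d)%:R * (2 * L) ^+ 2 <= eps ^+ 2 ->
  L * (eps * w%:R + 2 * (L * (d%:R * s%:R) + C) + d%:R) + C <= h%:R ->
  (forall (b : {ffun 'I_d -> 'I_mu}) (i : 'I_N),
     N%:R * inrm R (F (o + bvec b *+ s + e *+ (i.+1 * w))
                    - F (o + bvec b *+ s + e *+ (i * w))) <= (1 + k) * inrm R D) ->
  exists i : 'I_N, (S i <= S i.+1 + delta)%N /\ (S i.+1 <= S i + delta)%N.
Proof.
move=> w D S delta N0 k01 eps0 near Dle epsk hh hV.
have [i [v hv]] := checkerboard_alignment N0 k01 eps0 near Dle epsk hV.
have [_ hG YG Ginj Finj] := FG.
have SE : o + e *+ (i.+1 * w) = o + e *+ (i * w) + e *+ w.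
  by rewrite -addrA -mulrnDr mulSnr.
exists i; split.
  rewrite /S SE; apply: (leq_cnt_translation (v := v) L0 hG YG Ginj Finj _ hh) => x xin.
  rewrite (_ : F x + v - F (x + e *+ w) = - (F (x + e *+ w) - F x - v)) ?inrmN.
    exact: hv.
  by apply/rowP => j; rewrite !mxE; ring.
have -> : S i = cnt Y ((o + e *+ (i.+1 * w)) - e *+ w) w by rewrite SE addrK.
apply: (leq_cnt_translation (v := - v) L0 hG YG Ginj Finj _ hh) => x xin.
rewrite (_ : F x - v - F (x - e *+ w) = F ((x - e *+ w) + e *+ w) - F (x - e *+ w) - v).
  apply: hv; move: xin; rewrite SE.
  by rewrite [inbox (_ + _) w (x - _)](inbox_add _ _ (e *+ w)) addrC [e *+ w + (_ - _)]addrC subrK.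
by rewrite subrK; apply/rowP => j; rewrite !mxE; ring.
Qed.

(** Otherwise all edges of length [s] are stretched by at most (1 + k/2) A. A step across a cube is
    a sum of [mu] such edges, and (1 + k/2) <= (1 + k)(1 - k/4), so no step exceeds (1 + k) |D| / N.
    Then two consecutive cubes have nearly equal counts, against the last hypothesis. *)
Lemma checkerboard_step (o : P) (N mu s h : nat) (k eps A : R) :
  let w := (mu * s)%N in
  let m := (N.+1 * mu)%N in
  let S (i : nat) := cnt Y (o + e *+ (i * w)) w in
  let delta := (d * (2 * h * w ^ d.-1))%N in
  (0 < N)%N -> (0 < mu)%N -> 0 <= k <= 1 -> 0 <= eps -> C <= w%:R ->
  5 * k * (mu ^ d)%:R * (2 * L) ^+ 2 <= eps ^+ 2 ->
  4 * (L * d%:R + 1) <= N%:R * k * A -> 0 <= A ->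
  L * (eps * w%:R + 2 * (L * (d%:R * s%:R) + C) + d%:R) + C <= h%:R ->
  A * (m * s)%:R <= inrm R (F (o + e *+ (m * s)) - F o) ->
  (forall i : 'I_N, (S i + delta < S i.+1)%N \/ (S i.+1 + delta < S i)%N) ->
  exists c : {ffun 'I_d -> 'I_m},
    (1 + k / 2) * A * s%:R <= inrm R (F (o + bvec c *+ s + e *+ s) - F (o + bvec c *+ s)).
Proof.
move=> w m S delta N0 mu0 /andP[k0 k1] eps0 Cw epsk NA A0 hh hA hS.
have [hF _ _ _ _] := FG.
apply: contrapT => nc.
have hc (c : {ffun 'I_d -> 'I_m}) :
    inrm R (F (o + bvec c *+ s + e *+ s) - F (o + bvec c *+ s)) <= (1 + k / 2) * A * s%:R.
  by rewrite leNgt; apply/negP => /ltW hc; apply: nc; exists c.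
have d1 : 1 <= d%:R :> R by rewrite ler1n; case: (d) i0 => [[]|].
set D := F (o + e *+ (N * w)) - F o.
have w0 : 0 <= w%:R :> R by [].
have Np : 0 < N%:R :> R by rewrite ltr0n.
have eN n : inrm R (e *+ n) = n%:R by rewrite inrmMn inrm_delta mulr1.
have Dle : inrm R D <= 2 * L * (N%:R * w%:R).
  apply: le_trans (hF _ _) _; rewrite [X in X - _]addrC addrK eN natrM.
  have : w%:R <= N%:R * w%:R :> R by rewrite -natrM ler_nat leq_pmull.
  by have := L1; nra.
(* The block is N + 1 cubes long, which leaves room for the shifted rows, whereas [D] spans only [N]
   of them. The missing cube costs at most (L + 1) w, absorbed by the factor 1 - k/4. *)
have Dge : N%:R * w%:R * (A * (1 - k / 4)) <= inrm R D.
  have h1 : inrm R (F (o + e *+ (m * s)) - F o) <= inrm R D + (L * w%:R + C).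
    have -> : F (o + e *+ (m * s)) - F o = D + (F (o + e *+ (m * s)) - F (o + e *+ (N * w))).
      by apply/rowP => j; rewrite !mxE; ring.
    apply: le_trans (inrmD _ _ _) _; rewrite lerD2l.
    apply: le_trans (hF _ _) _; rewrite lerD2r ler_wpM2l //.
    by rewrite /m -mulnA -/w mulSn [(w + _)%N]addnC mulrnDr addrA [X in X - _]addrC addrK eN.
  have h2 := le_trans hA h1; rewrite /m -mulnA -/w natrM -natr1 in h2.
  have h3 : (L + 1) * w%:R <= (N%:R * k * A / 4) * w%:R.
    by apply: ler_wpM2r => //; have := L1; nra.
  have : 0 <= A * w%:R by rewrite mulr_ge0.
  lra.
have near : 2 * (L * (d%:R * w%:R) + C) <= k * inrm R D.
  apply: le_trans (ler_wpM2l k0 Dge).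
  have : 0 <= (N%:R * k * A - 4 * (L * d%:R + 1)) * w%:R by rewrite mulr_ge0 // subr_ge0.
  have : 0 <= (N%:R * k * A) * w%:R * (1 - k) by rewrite !mulr_ge0 ?subr_ge0 // ltW.
  have : 0 <= L * d%:R * w%:R by rewrite !mulr_ge0.
  lra.
have k01 : 0 <= k <= 1 by rewrite k0.
have [|i [hi1 hi2]] := @checkerboard_counts o N mu s h k eps N0 k01 eps0 near Dle epsk hh.
  move=> b i.
  have hedge : inrm R (F (o + bvec b *+ s + e *+ (i.+1 * w))
                    - F (o + bvec b *+ s + e *+ (i * w))) <= (1 + k / 2) * A * w%:R.
    pose f j := F (o + bvec b *+ s + e *+ (i * w) + e *+ (j * s)).
    have -> : F (o + bvec b *+ s + e *+ (i.+1 * w)) - F (o + bvec b *+ s + e *+ (i * w))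
        = \sum_(t < mu) (f t.+1 - f t).
      rewrite -(big_mkord xpredT (fun t => f t.+1 - f t)) telescope_sumr //.
      by rewrite /f mul0n mulr0n addr0 mulSnr mulrnDr !addrA.
    apply: le_trans (inrm_sum _ _) _.
    rewrite /w natrM [mu%:R * _]mulrC mulrA [leRHS]mulr_natr -[in leRHS](card_ord mu) -sumr_const.
    apply: ler_sum => t _.
    have cin : inbox 0 m (bvec b + e *+ (i * mu + t)).
      apply/forallP => j; rewrite !mxE mulvnE !mxE eqxx andTb.
      have : (i.+1 * mu <= N * mu)%N by rewrite leq_mul2r ltn_ord orbT.
      rewrite /m !mulSn; move: (i * mu)%N (N * mu)%N => p q.
      case: (b j) => n /= hn; case: (t) => n' /= hn' hpq.
      by clear -hn hn' hpq; case: (j == i0) => /=; lia.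
    have /inboxP[c] := cin; rewrite add0r => cE.
    have := hc c; rewrite -cE mulrnDl -mulrnA mulnDl -mulnA -/w mulrnDr !addrA.
    by rewrite /f mulSnr mulrnDr !addrA.
  apply: le_trans (ler_wpM2l (ltW Np) hedge) _.
  apply: le_trans (ler_wpM2l (_ : 0 <= 1 + k) Dge); last by rewrite addr_ge0.
  have : 0 <= N%:R * w%:R * A * k * (1 - k).
    by rewrite !mulr_ge0 ?subr_ge0 // ltW.
  lra.
by have [] := hS i; rewrite ltnNge ?hi1 ?hi2.
Qed.

End Checkerboard.

(** * The self-similar pattern and the iterated gain of stretch *)

Section SelfSimilarPattern.
Variables (R : realType) (d : nat) (i0 i1 : 'I_d).
Hypothesis i01 : i0 != i1.
Local Notation P := 'rV[int]_d.
Local Notation e := (delta_mx 0 i0 : P).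
Variables (N mu : nat).
Hypothesis mu0 : (0 < mu)%N.
Let m := (N.+1 * mu)%N.

(* Slabs of alternating colours across direction i0 along one face of the block;
   the other cells keep the colour t of the block. *)
Definition slab_colour (t : bool) (c : {ffun 'I_d -> 'I_m}) : bool :=
  if (c i1 < mu)%N then odd (c i0 %/ mu) else t.

Fixpoint self_similar (Y : pred P) (U : bool -> nat) (s j : nat) (t : bool) (o : P) : Prop :=
  if j is j'.+1 then
    forall c, self_similar Y U s j' (slab_colour t c) (o + bvec c *+ (m ^ j' * s))
  else cnt Y o s = U t.

Fixpoint level_cnt (U : bool -> nat) (j : nat) (t : bool) : nat :=
  if j is j'.+1 then (\sum_c level_cnt U j' (slab_colour t c))%N else U t.

(** Flattens the recursion into one finite colouring independent of [Y], [U] and [s], so that it can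
    be looked up in a dictionary. *)
Lemma self_similar_pattern (j : nat) (t : bool) :
  exists pi : {ffun 'I_d -> 'I_(m ^ j)} -> bool, forall Y U s o,
    (forall c, cnt Y (o + bvec c *+ s) s = U (pi c)) -> self_similar Y U s j t o.
Proof.
elim: j t => [|j IH] t.
  exists (fun=> t) => Y U s o /(_ [ffun=> Ordinal (ltn0Sn 0)]).
  rewrite (_ : bvec _ = 0) ?mul0rn ?addr0 //.
  by apply/rowP => i; rewrite !mxE ffunE.
have [g gK Kg] := bjoin_bij d m (m ^ j).
have [pi hpi] := choice IH.
rewrite expnS.
exists (fun c => pi (slab_colour t (g c).1) (g c).2) => Y U s o h c.
apply: hpi => a; have := h (bjoin (c, a)).
by rewrite gK /= bvec_bjoin mulrnDl -mulrnA addrA.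
Qed.

Lemma self_similar_cnt Y U s j t o : self_similar Y U s j t o ->
  cnt Y o (m ^ j * s) = level_cnt U j t.
Proof.
elim: j t o => [|j IH] t o h; first by rewrite mul1n.
by rewrite expnS -mulnA cnt_split; apply: eq_bigr => c _; apply: IH.
Qed.

(** All mu^d subcells of the cube have colour [odd i]: since [i0] and [i1] differ, moving along [i0]
    stays in the slab where coordinate [i1] is below [mu]. *)
Lemma slab_cnt Y U s j t o (i : nat) : (i <= N)%N -> self_similar Y U s j.+1 t o ->
  let w := (mu * (m ^ j * s))%N in
  cnt Y (o + e *+ (i * w)) w = (mu ^ d * level_cnt U j (odd i))%N.
Proof.
move=> iN h w; rewrite cnt_split -[in RHS](card_ord mu) -[in RHS](card_ord d) -card_ffun.
rewrite -sum_nat_const; apply: eq_bigr => b _.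
have bm k : (i * mu + b k < m)%N.
  apply: (@leq_trans (i.+1 * mu)); first by rewrite mulSn addnC ltn_add2r.
  by rewrite leq_mul2r ltnS iN orbT.
have bm' k : (b k < m)%N by apply: leq_ltn_trans (bm k); rewrite leq_addl.
pose c : {ffun 'I_d -> 'I_m} :=
  [ffun k => if k == i0 then Ordinal (bm k) else Ordinal (bm' k)].
have cE : bvec c = e *+ (i * mu) + bvec b.
  apply/rowP => k; rewrite [RHS]mxE mulvnE !mxE ffunE eqxx /=.
  case: (k == i0) => /=; last by rewrite mul0r add0r.
  by rewrite mul1r PoszD.
have := self_similar_cnt (h c).
rewrite /slab_colour !ffunE eqxx [i1 == i0]eq_sym (negbTE i01) /= ltn_ord.
rewrite divnMDl // divn_small // addn0 => <-.
by congr (cnt _ _ _); rewrite cE mulrnDl -mulrnA -mulnA addrA.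
Qed.

(** The slab is one of N + 1 layers, so each level multiplies the gap by at least 1 - 1/(N + 1), and
    the product of [j] such factors is at least 1 - j/(N + 1). *)
Lemma level_gap (U : bool -> nat) (g : R) (s j : nat) : (j <= N)%N -> 0 <= g ->
  g * (s ^ d)%:R <= (U true)%:R - (U false)%:R ->
  g * (1 - j%:R / N.+1%:R) * ((m ^ j * s) ^ d)%:R
    <= (level_cnt U j true)%:R - (level_cnt U j false)%:R.
Proof.
move=> + g0 hg; elim: j => [_|j IH jN]; first by rewrite mul0r subr0 mulr1 mul1n.
have {}IH := IH (ltnW jN).
pose gap : R := (level_cnt U j true)%:R - (level_cnt U j false)%:R.
pose K : nat := #|[pred c : {ffun 'I_d -> 'I_m} | (mu <= c i1)%N]|.
have -> : (level_cnt U j.+1 true)%:R - (level_cnt U j.+1 false)%:R = K%:R * gap :> R.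
  rewrite /= !natr_sum -sumrB (bigID (fun c : {ffun 'I_d -> 'I_m} => (mu <= c i1)%N)) /=.
  rewrite [X in _ + X]big1 ?addr0 => [|c]; last first.
    by rewrite -ltnNge /slab_colour => ->; rewrite subrr.
  rewrite (eq_bigr (fun=> gap)) => [|c]; last by rewrite /slab_colour ltnNge => ->.
  by rewrite sumr_const mulr_natl.
have d0 : (0 < d)%N by case: (d) i0 => [[]|].
have KE : (m ^ d <= K + mu * m ^ d.-1)%N.
  rewrite -card_box -(cardC [pred c : {ffun 'I_d -> 'I_m} | (mu <= c i1)%N]) leq_add2l.
  apply: leq_trans (card_box_lt m mu i1); apply/eq_leq/eq_card => c.
  by rewrite !inE -ltnNge.
have Kge : (1 - N.+1%:R^-1) * (m ^ d)%:R <= K%:R :> R.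
  have -> : (m ^ d)%:R = N.+1%:R * (mu * m ^ d.-1)%:R :> R.
    by rewrite -natrM mulnA -expnS prednK.
  rewrite mulrA mulrBl mul1r mulVf ?pnatr_eq0 // mulrBl mul1r lerBlDr -natrM -natrD ler_nat.
  by apply: leq_trans KE; rewrite mulnA -expnS prednK.
rewrite expnS -mulnA expnMn natrM.
apply: (@le_trans _ _ ((1 - N.+1%:R^-1) * (m ^ d)%:R *
  (g * (1 - j%:R / N.+1%:R) * ((m ^ j * s) ^ d)%:R))).
  rewrite -natr1 mulrDl mul1r.
  have h : 0 <= j%:R / N.+1%:R / N.+1%:R :> R by rewrite !divr_ge0.
  have h2 : 0 <= g * (m ^ d)%:R * ((m ^ j * s) ^ d)%:R by rewrite !mulr_ge0.
  rewrite -subr_ge0; set z := ((m ^ j * s) ^ d)%:R in h2 *.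
  apply: le_trans (mulr_ge0 h h2) _; rewrite le_eqVlt; apply/orP; left; apply/eqP; ring.
apply: ler_pM => //; rewrite ?mulr_ge0 //.
- by rewrite subr_ge0 invf_le1 ?ltr0n // ler1n.
- by rewrite subr_ge0 ler_pdivrMr ?ltr0n // mul1r ler_nat ltnW // ltnW.
Qed.


(** Every subcell again carries the pattern, of depth one less and of either colour, so the subcell
    that [checkerboard_step] finds can be fed to the induction. As 2 J <= N, at least half of the
    density gap [g] survives at every level used. *)
Lemma self_similar_descent (L C g k eps : R) (Y : pred P) (F G : P -> P) (U : bool -> nat)
    (s J : nat) :
  1 <= L -> 0 <= C -> 0 < g -> 0 <= k <= 1 -> 0 < eps ->
  coarse_bilipschitz L C Y F G ->
  g * (s ^ d)%:R <= (U true)%:R - (U false)%:R ->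
  (2 * J <= N)%N -> (0 < N)%N -> C <= s%:R -> (0 < s)%N ->
  5 * k * (mu ^ d)%:R * (2 * L) ^+ 2 <= eps ^+ 2 ->
  4 * (L * d%:R + 1) <= N%:R * k / (2 * L) ->
  16 * d%:R * L * eps <= g ->
  32 * L ^+ 2 * d%:R ^+ 2 <= g * mu%:R ->
  16 * d%:R * (2 * L * C + L * d%:R + C + 1) < g * s%:R ->
  forall j t o A, (j <= J)%N -> self_similar Y U s j t o -> (2 * L)^-1 <= A ->
    A * (m ^ j * s)%:R <= inrm R (F (o + e *+ (m ^ j * s)) - F o) ->
    exists o', (1 + k / 2) ^+ j * A * s%:R <= inrm R (F (o' + e *+ s) - F o').
Proof.
move=> L1 C0 g0 k01 eps0 FG hU JN N0 Cs s0 epsk NA geps gmu gs.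
have L0 : 0 < L by apply: lt_le_trans L1.
have m0 : (0 < m)%N by rewrite muln_gt0.
have d0 : (0 < d)%N by case: (d) i0 => [[]|].
elim=> [|j IH] t o A jJ ht hA hF.
  by exists o; rewrite expr0 mul1r; rewrite mul1n in hF.
have A0 : 0 <= A by apply: le_trans hA; rewrite invr_ge0 mulr_ge0 ?ltW.
have [k0 k1] := andP k01.
set s' := (m ^ j * s)%N.
have ss' : (s <= s')%N by rewrite leq_pmull // expn_gt0 m0.
have s'w : (s' <= mu * s')%N by rewrite leq_pmull.
set w := (mu * s')%N in s'w.
have w0 : (0 < w)%N by apply: leq_trans s'w; apply: leq_trans ss'.
pose h := Num.truncn (L * (eps * w%:R + 2 * (L * (d%:R * s'%:R) + C) + d%:R) + C + 1).
set lhs := L * (eps * w%:R + 2 * (L * (d%:R * s'%:R) + C) + d%:R) + C in h *.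
have lhs0 : 0 <= lhs + 1.
  by rewrite /lhs ?(addr_ge0, mulr_ge0) // ltW.
have hh : lhs <= h%:R.
  have := truncnS_gt (lhs + 1); rewrite -/h -natr1; lra.
have hh' : h%:R <= lhs + 1 by rewrite truncn_le.
(* The depth [h] comes from the alignment error, the grid error at scale [s'] and a constant;
   [geps], [gmu] and [gs] bound each share by a quarter of g w. *)
have hdelta : (4 * d%:R) * h%:R < g * w%:R.
  have wE : w%:R = mu%:R * s'%:R :> R by rewrite natrM.
  have b1 : 16 * d%:R * L * eps * w%:R <= g * w%:R by rewrite ler_wpM2r.
  have b2 : 32 * L ^+ 2 * d%:R ^+ 2 * s'%:R <= g * w%:R.
    by rewrite wE mulrA ler_wpM2r.
  have b3 : 16 * d%:R * (2 * L * C + L * d%:R + C + 1) < g * w%:R.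
    apply: lt_le_trans gs _; rewrite ler_pM2l // ler_nat.
    exact: leq_trans s'w.
  apply: le_lt_trans (ler_wpM2l _ hh') _; first by rewrite mulr_ge0.
  have gw : 0 < g * w%:R by rewrite mulr_gt0 ?ltr0n.
  rewrite /lhs; lra.
have [||||c hc] := @checkerboard_step R d i0 L C Y F G L1 FG o N mu s' h k eps A
   N0 mu0 k01 (ltW eps0) _ epsk _ A0 hh.
- by apply: le_trans Cs _; rewrite ler_nat; exact: leq_trans s'w.
- apply: le_trans NA _; apply: ler_wpM2l => //; exact: mulr_ge0.
- by rewrite /s' mulnA -expnS.
- move=> i; have := ltn_ord i => iN.
  rewrite !(slab_cnt _ ht) ?(ltnW iN) //.
  have jN0 : (j <= N)%N.
    by apply: leq_trans JN; rewrite mul2n -addnn (leq_trans (ltnW jJ)) // leq_addl.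
  have gapE := level_gap jN0 (ltW g0) hU.
  have : (mu ^ d * level_cnt U j false + d * (2 * h * w ^ d.-1) < mu ^ d * level_cnt U j true)%N.
    have jN : j%:R / N.+1%:R <= 2^-1 :> R.
      rewrite ler_pdivrMr ?ltr0n // ler_pdivlMl ?ltr0n // -natrM ler_nat.
      by apply: leq_trans (leqW JN); rewrite leq_mul2l ltnW.
    rewrite -(ltr_nat R) natrD -ltrBrDl !natrM -mulrBr.
    have gap2 := ler_wpM2l (ler0n R (mu ^ d)) gapE.
    apply: lt_le_trans gap2.
    have wd : 0 < w%:R ^+ d.-1 :> R by rewrite exprn_gt0 ?ltr0n.
    have wdE : w%:R * w%:R ^+ d.-1 = (mu ^ d)%:R * (s' ^ d)%:R :> R.
      by rewrite -exprS prednK // -natrM -expnMn natrX.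
    rewrite -/s' natrX; set x := 1 - _; set W := w%:R ^+ d.-1 in wd wdE *.
    have -> : (mu ^ d)%:R * (g * x * (s' ^ d)%:R) = g * x * (w%:R * W) by rewrite wdE; ring.
    have h1 : 4 * d%:R * h%:R * W < g * w%:R * W by rewrite ltr_pM2r.
    have h2 : 0 <= g * w%:R * W * (x - 2^-1).
      have x2 : 0 <= x - 2^-1 by rewrite /x; move: jN; move: (j%:R / _) => y; lra.
      by rewrite mulr_ge0 // !mulr_ge0 // ltW.
    lra.
  by rewrite /=; case: (odd i) => /= ?; [right|left].
have [||o' ho'] := IH _ _ ((1 + k / 2) * A) (ltnW jJ) (ht c) _ _.
- by apply: le_trans hA _; rewrite mulrDl mul1r lerDl ?mulr_ge0 ?divr_ge0.
- exact: hc.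
by exists o'; rewrite exprSr -[_ * _ * A]mulrA.
Qed.

End SelfSimilarPattern.

(** The initial stretch is at least 1/(2L), and [J] gains of 1 + k/2 push it above 2L, more than [F]
    allows at scale [s]. The pattern depends on [L] and [g] only; the additive error [C] is made
    harmless by taking [s] large. *)
Theorem no_coarse_bilipschitz (R : realType) (d : nat) (i0 i1 : 'I_d) (L g : R) :
  i0 != i1 -> 1 <= L -> 0 < g ->
  exists M (pi : {ffun 'I_d -> 'I_M} -> bool), forall C : R, 0 <= C ->
    exists s0 : nat, forall s, (s0 <= s)%N ->
    forall (Y : pred 'rV[int]_d) F G (U : bool -> nat) o,
      coarse_bilipschitz L C Y F G ->
      g * (s ^ d)%:R <= (U true)%:R - (U false)%:R ->
      (forall c, cnt Y (o + bvec c *+ s) s = U (pi c)) -> False.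
Proof.
move=> i01 L1 g0.
have L0 : 0 < L by apply: lt_le_trans L1.
have d1 : 1 <= d%:R :> R by rewrite ler1n (leq_ltn_trans _ (ltn_ord i0)).
have d0 : 0 < d%:R :> R by apply: lt_le_trans d1.
(* Each constant depends on the previous ones: [eps] and [mu] keep the boundary losses below the
   gap, [k] makes the alignment error at most [eps], [J] gives (1 + k/2)^J > 4 L^2 by Bernoulli, and
   [N] is large enough for all [J] steps. *)
pose eps := g / (16 * d%:R * L).
have eps0 : 0 < eps by rewrite divr_gt0 ?mulr_gt0.
pose mu := (Num.truncn (32 * L ^+ 2 * d%:R ^+ 2 / g)).+1.
have gmu : 32 * L ^+ 2 * d%:R ^+ 2 <= g * mu%:R.
  by rewrite [g * _]mulrC -ler_pdivrMr //; apply/ltW/truncnS_gt.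
have mud : 0 < (mu ^ d)%:R :> R by rewrite ltr0n expn_gt0.
pose k := Num.min 1 (eps ^+ 2 / (5 * (mu ^ d)%:R * (2 * L) ^+ 2)).
have k0 : 0 < k.
  by rewrite lt_min ltr01 divr_gt0 ?exprn_gt0 // !mulr_gt0 // exprn_gt0 // mulr_gt0.
have k1 : k <= 1 by rewrite ge_min lexx.
have epsk : 5 * k * (mu ^ d)%:R * (2 * L) ^+ 2 <= eps ^+ 2.
  have h : k <= eps ^+ 2 / (5 * (mu ^ d)%:R * (2 * L) ^+ 2) by rewrite ge_min lexx orbT.
  move: h; rewrite ler_pdivlMr; last by rewrite !mulr_gt0 // exprn_gt0 // mulr_gt0.
  by apply: le_trans; rewrite le_eqVlt; apply/orP; left; apply/eqP; ring.
pose J := (Num.truncn (8 * L ^+ 2 / k)).+1.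
have JP : 4 * L ^+ 2 < (1 + k / 2) ^+ J.
  have h : 8 * L ^+ 2 < k * J%:R by rewrite [k * _]mulrC -ltr_pdivrMr //; apply: truncnS_gt.
  apply: (@lt_le_trans _ _ (1 + J%:R * (k / 2))); first lra.
  elim: (J) => [|n IH]; first by rewrite mul0r addr0 expr0.
  rewrite exprSr; apply: le_trans (ler_wpM2r _ IH); last lra.
  rewrite -natr1; have : 0 <= n%:R * (k / 2) * (k / 2) by rewrite !mulr_ge0 ?invr_ge0 ?(ltW k0).
  lra.
pose N := (maxn (2 * J) (Num.truncn (4 * (L * d%:R + 1) / (k / (2 * L)))).+1).
have JN : (2 * J <= N)%N by rewrite leq_maxl.
have N0 : (0 < N)%N by apply: leq_trans JN; rewrite muln_gt0.
have NA : 4 * (L * d%:R + 1) <= N%:R * k / (2 * L).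
  rewrite -mulrA -ler_pdivrMr ?divr_gt0 ?mulr_gt0 //.
  apply/ltW/(lt_le_trans (truncnS_gt _)).
  by rewrite ler_nat leq_maxr.
have geps : 16 * d%:R * L * eps <= g.
  by rewrite /eps mulrC divfK // gt_eqF // !mulr_gt0.
have mu0 : (0 < mu)%N by [].
exists ((N.+1 * mu) ^ J)%N.
have [pi hpi] := @self_similar_pattern d i0 i1 N mu J true.
exists pi => C C0.
pose s0 := (Num.truncn (16 * d%:R * (2 * L * C + L * d%:R + C + 1) / g
   + 4 * C)).+1.
exists s0 => s ss0 Y F G U o FG hU hc.
have sgt : 16 * d%:R * (2 * L * C + L * d%:R + C + 1) / g + 4 * C < s%:R.
  by apply: lt_le_trans (truncnS_gt _) _; rewrite ler_nat.
have lhs0 : 0 <= 16 * d%:R * (2 * L * C + L * d%:R + C + 1) / g.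
  have L0' := ltW L0; apply: divr_ge0; last exact: ltW.
  by rewrite !(mulr_ge0, addr_ge0).
have gs : 16 * d%:R * (2 * L * C + L * d%:R + C + 1) < g * s%:R.
  by rewrite [g * _]mulrC -ltr_pdivrMr //; lra.
have Cs : 4 * C <= s%:R by lra.
have spos : (0 < s)%N by apply: leq_trans ss0.
have k01 : 0 <= k <= 1 by rewrite ltW.
set m := (N.+1 * mu)%N in pi hpi hc.
have m0 : (0 < m)%N by rewrite muln_gt0.
have [hF hG _ _ _] := FG.
have s1 : 0 < s%:R :> R by rewrite ltr0n.
pose S := (m ^ J * s)%N.
have eN n : inrm R (delta_mx 0 i0 *+ n : 'rV[int]_d) = n%:R by rewrite inrmMn inrm_delta mulr1.
(* Since [G] nearly inverts [F], S - 2 C <= L |q - F o| + C - C holds up to these errors, and 4 C <=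
   S leaves at least S / 2. *)
have hA : (2 * L)^-1 * S%:R <= inrm R (F (o + delta_mx 0 i0 *+ S) - F o).
  set q := F (o + _).
  have h1 : inrm R (G q - (o + delta_mx 0 i0 *+ S)) <= C.
    by apply: le_trans (hG _ _) _; rewrite subrr inrm0 mulr0 add0r.
  have h2 := hG q o.
  have h3 : S%:R <= C + inrm R (G q - o).
    apply: le_trans (lerD h1 (lexx _)); rewrite [inrm R (_ - (_ + _))]inrmB.
    apply: le_trans (inrmD _ _ _).
    by rewrite addrA subrK [X in X - _]addrC addrK eN.
  have h4 : 4 * C <= S%:R.
    by apply: le_trans Cs _; rewrite ler_nat leq_pmull // expn_gt0 m0.
  rewrite mulrC ler_pdivrMr ?mulr_gt0 //; lra.
have CS : C <= s%:R by lra.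
have [p hp] := self_similar_descent i01 mu0 L1 C0 g0 k01 eps0 FG hU JN N0 CS spos epsk NA
  geps gmu gs (leqnn J) (hpi _ _ _ _ hc) (lexx _) hA.
have := le_trans hp (hF _ _); rewrite [X in X - _]addrC addrK eN.
apply/negP; rewrite -ltNge.
apply: (@le_lt_trans _ _ (2 * L * s%:R)).
  have : 0 <= (L - 1) * s%:R by rewrite mulr_ge0 // subr_ge0.
  lra.
rewrite ltr_pM2r // ltr_pdivlMr ?mulr_gt0 //.
apply: le_lt_trans JP; rewrite le_eqVlt; apply/orP; left; apply/eqP; ring.
Qed.

(** * Hierarchical colourings *)

Section Hierarchy.
Variables (R : realType) (d : nat).
Local Notation P := 'rV[int]_d.
Variables (n m : nat -> nat) (q : nat -> P) (rule : nat -> bool -> P -> bool).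
(* [n k] is the ratio of the sides of the cells of levels k+1 and k, [q k] the
   position of the cell 0 of level k inside the cell 0 of level k+1, and
   [rule k b a] the colour of the subcell at a of a cell of level k+1 of colour b. *)
Hypotheses (n_gt0 : forall k, (0 < n k)%N) (m_gt1 : forall k, (1 < m k)%N).
Hypothesis q_bounds : forall k i, (0 < q k 0 i) && (q k 0 i + 1 < (n k)%:Z).
Hypothesis rule_centre : forall k b, rule k b (q k) = true.
Hypothesis rule_universal : forall k (pi : {ffun 'I_d -> 'I_(m k)} -> bool),
  exists u : P, forall b c, inbox 0 (n k) (u + bvec c) /\ rule k b (u + bvec c) = pi c.
Hypothesis rule_generic : forall k a,
  rule k true a != rule k false a -> forall b, rule k b a = b.

Definition vdiv (v : P) (s : nat) : P := \row_i divz (v 0 i) s%:Z.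
Definition vmod (v : P) (s : nat) : P := \row_i modz (v 0 i) s%:Z.
Definition vsize (v : P) : nat := \max_(i < d) absz (v 0%R i).

(* The recursion goes up the hierarchy; it stops because the index of the cell
   shrinks to 0, and the cells of index 0 have colour [true] at every level. *)
Fixpoint colour_rec (fuel k : nat) (v : P) : bool :=
  if fuel is f.+1 then
    rule k (colour_rec f k.+1 (vdiv (v + q k) (n k))) (vmod (v + q k) (n k))
  else true.

Definition colour (k : nat) (v : P) : bool := colour_rec (vsize v) k v.

Lemma vdivmod (v : P) (s : nat) : (0 < s)%N ->
  v = vdiv v s *+ s + vmod v s /\ inbox 0 s (vmod v s).
Proof.
move=> s0; split.
  by apply/rowP => i; rewrite mxE mulvnE !mxE -divz_eq.
apply/forallP => i; rewrite !mxE add0r modz_ge0 ?ltz_pmod ?ltz_nat //.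
by rewrite gt_eqF // ltz_nat.
Qed.

Lemma vdivmod_uniq (v a : P) (s : nat) : (0 < s)%N -> inbox 0 s a ->
  vdiv (v *+ s + a) s = v /\ vmod (v *+ s + a) s = a.
Proof.
move=> s0 /forallP ha; have s0' : s%:Z != 0 by rewrite gt_eqF // ltz_nat.
have ai i : (0 <= a 0 i) && (a 0 i < s%:Z) by have := ha i; rewrite mxE add0r.
have e i : (v *+ s + a) 0 i = v 0 i * s%:Z + a 0 i by rewrite mxE mulvnE.
split; apply/rowP => i; have /andP[a1 a2] := ai i; rewrite mxE e.
  by rewrite divzMDl // divz_small ?addr0 // a1 /=.
by rewrite modzMDl modz_small // a1 /=.
Qed.

Lemma vsize_eq0 v : vsize v = 0%N -> v = 0.
Proof.
move=> v0; apply/rowP => i; rewrite mxE; apply/eqP; rewrite -absz_eq0 -leqn0.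
apply: leq_trans (_ : (vsize v <= 0)%N); last by rewrite v0.
exact: (leq_bigmax i).
Qed.

(** The cell 0 lies strictly inside its parent, away from all faces; hence the neighbouring indices
    1 and -1 go to 0, and any other nonzero coordinate also moves towards 0. *)
Lemma vsize_descent v k : (vsize (vdiv (v + q k) (n k)) <= (vsize v).-1)%N.
Proof.
apply/bigmax_leqP => i _; rewrite !mxE.
have : (absz (v 0%R i) <= vsize v)%N by exact: (leq_bigmax i).
have /andP[] := q_bounds k i; move: (vsize v) (v 0 i) => c z.
have b0 : (0 : int) < (n k)%:Z by rewrite ltz_nat n_gt0.
move: (q k 0 i) ((n k)%:Z) b0 => a b b0 a0 ab zc.
have h1 := lez_floor (z + a) (lt0r_neq0 b0).
have h2 := ltz_ceil (z + a) b0.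
move: (divz _ _) h1 h2 => y h1 h2.
case: (ltrgt0P z) => hz.
- have : y <= z - 1 by nia.
  have : 0 <= y by nia.
  by clear -zc hz; lia.
- have : z + 1 <= y by nia.
  have : y <= 0 by nia.
  by clear -zc hz; lia.
- have : y = 0 by nia.
  by move=> ->.
Qed.

Lemma colour_rec0 f k : colour_rec f k 0 = true.
Proof.
elim: f k => [//|f IH] k /=.
have h : inbox 0 (n k) (q k).
  apply/forallP => i; rewrite !mxE; have := q_bounds k i; move: (q k 0 i) (n k) => a b; lia.
have [h1 h2] := vdivmod_uniq 0 (n_gt0 k) h.
rewrite mul0rn in h1 h2; by rewrite h1 h2 IH rule_centre.
Qed.

Lemma colour_rec_stable f f' k v : (vsize v <= f)%N -> (vsize v <= f')%N ->
  colour_rec f k v = colour_rec f' k v.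
Proof.
elim: f f' k v => [|f IH] [|f'] k v //.
- by rewrite leqn0 => /eqP/vsize_eq0-> _; rewrite !colour_rec0.
- by move=> _; rewrite leqn0 => /eqP/vsize_eq0->; rewrite !colour_rec0.
move=> vf vf'; rewrite /=; congr rule; have := vsize_descent v k.
by move: (vsize v) vf vf' => c vf vf' h; apply: IH; lia.
Qed.

(** The equation the recursion is meant to solve. The fuel disappears because any amount above the
    size of the index gives the same colour. *)
Lemma colourE k v a : inbox 0 (n k) a ->
  colour k (v *+ n k + a - q k) = rule k (colour k.+1 v) a.
Proof.
move=> ha; set u := _ - _; rewrite /colour (@colour_rec_stable _ (vsize u).+1) //=.
have [h1 h2] := vdivmod_uniq v (n_gt0 k) ha.
rewrite {2 3}/u subrK h1 h2; congr rule; apply: colour_rec_stable => //.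
by have := vsize_descent u k; rewrite {1}/u subrK h1 => /leq_trans; apply; exact: leq_pred.
Qed.

Fixpoint side (k : nat) : nat := if k is k'.+1 then (n k' * side k')%N else 1%N.
(** The point 0 sits at position [offset k] inside the cell 0 of level [k], whose lowest corner is
    thus [- offset k]. *)
Fixpoint offset (k : nat) : P :=
  if k is k'.+1 then offset k' + q k' *+ side k' else 0.
Definition corner (k : nat) (v : P) : P := v *+ side k - offset k.

Lemma side_gt0 k : (0 < side k)%N.
Proof. by elim: k => //= k IH; rewrite muln_gt0 n_gt0. Qed.

Lemma corner_sub k v a : corner k (v *+ n k + a - q k) = corner k.+1 v + a *+ side k.
Proof.
rewrite /corner /= mulrnBl mulrnDl -mulrnA opprD !addrA -!addrA; congr (_ + _).
by rewrite [LHS]addrCA [RHS]addrCA [- offset k + _]addrC.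
Qed.

Lemma corner_add k v a : corner k (v + a) = corner k v + a *+ side k.
Proof. by rewrite /corner mulrnDl addrAC. Qed.

Lemma in_cell k p : exists v, inbox (corner k v) (side k) p.
Proof.
have [h1 h2] := vdivmod (p + offset k) (side_gt0 k).
exists (vdiv (p + offset k) (side k)).
rewrite (inbox_add _ _ (vdiv (p + offset k) (side k) *+ side k - offset k)) addr0 in h2.
by rewrite addrAC -h1 addrK in h2.
Qed.

(** The rule sees only the level, the colour of the parent and the relative position, so equal
    colours propagate down to the points. *)
Lemma colour0_local k v v' a : colour k v = colour k v' -> inbox 0 (side k) a ->
  colour 0 (corner k v + a) = colour 0 (corner k v' + a).
Proof.
elim: k v v' a => [|k IH] v v' a vv' ha.
  have -> : a = 0.
    apply/rowP => i; have /forallP/(_ i) := ha; rewrite !mxE.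
    by move: (a 0 i) => z; rewrite /side; lia.
  by rewrite !addr0 /corner !mulr1n !subr0.
have [b hb] := inbox_split ha; rewrite add0r in hb.
set r := a - bvec b *+ side k.
have hr : inbox 0 (side k) r.
  by rewrite (inbox_add _ _ (bvec b *+ side k)) addr0 addrC subrK.
have -> : a = bvec b *+ side k + r by rewrite addrC subrK.
clearbody r.
rewrite !addrA -!corner_sub; apply: IH => //.
by rewrite !colourE ?inbox_bvec // vv'.
Qed.

Fixpoint cell_cnt (k : nat) (b : bool) : nat :=
  if k is k'.+1 then (\sum_(a : {ffun 'I_d -> 'I_(n k')}) cell_cnt k' (rule k' b (bvec a)))%N
  else b.

Lemma cnt_cell k v : cnt (colour 0) (corner k v) (side k) = cell_cnt k (colour k v).
Proof.
elim: k v => [|k IH] v.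
  rewrite /corner /= mulr1n subr0 /cnt.
  rewrite (_ : [set a : {ffun 'I_d -> 'I_1} | _] = [set a | colour 0 v]); last first.
    apply/setP => a; rewrite !inE (_ : bvec a = 0) ?addr0 //.
    by apply/rowP => i; rewrite !mxE ord1.
  case: (colour 0 v).
    by rewrite (eq_card (B := predT)) ?card_box ?exp1n // => a; rewrite !inE.
  by apply: eq_card0 => a; rewrite !inE.
rewrite cnt_split; apply: eq_bigr => a _.
by rewrite -corner_sub IH colourE // inbox_bvec.
Qed.

Lemma colour_block k (pi : {ffun 'I_d -> 'I_(m k)} -> bool) w :
  exists v, inbox (corner k.+1 w) (side k.+1) (corner k v) /\
    forall c, colour k (v + bvec c) = pi c.
Proof.
have [u hu] := rule_universal pi; exists (w *+ n k + u - q k); split; last first.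
  move=> c; have [/colourE h3 _] := hu true c.
  by rewrite addrAC -[_ + u + _]addrA h3; case: (hu (colour k.+1 w) c).
rewrite corner_sub -{1}[corner k.+1 w]addr0 -inbox_add.
have m0 : (0 < m k)%N by apply: ltnW.
have [+ _] := hu true [ffun=> Ordinal m0].
rewrite (_ : bvec _ = 0) ?addr0 => [/forallP h|]; last first.
  by apply/rowP => i; rewrite !mxE ffunE.
apply/forallP => i; have := h i; rewrite mulvnE !mxE /=.
have := side_gt0 k; move: (side k) (n k) (u 0 i) => a b z; nia.
Qed.

(** Since m k >= 2, the 2^d-block at [v] is part of a pattern of side [m k], which the dictionary of
    the cell [w] contains. Equality of the cell colours becomes equality of points by
    [colour0_local]. *)
Lemma colour_recurrence k v w : exists t,
  (forall p, inbox (corner k v) (2 * side k) p -> colour 0 (p + t) = colour 0 p) /\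
  inbox (corner k.+1 w) (side k.+1) (corner k v + t).
Proof.
have [v' [h1 h2]] := colour_block (fun c : {ffun 'I_d -> 'I_(m k)} => colour k (v + bvec c)) w.
have cE c : corner k (v + c) + (v' - v) *+ side k = corner k (v' + c).
  by rewrite -corner_add addrAC [v + _]addrC subrK.
exists ((v' - v) *+ side k); split; last by have := cE 0; rewrite !addr0 => ->.
move=> p /inbox_split[b hb]; rewrite -corner_add in hb.
have pE : p = corner k (v + bvec b) + (p - corner k (v + bvec b)).
  by rewrite [RHS]addrC subrK.
have hr : inbox 0 (side k) (p - corner k (v + bvec b)).
  by rewrite (inbox_add _ _ (corner k (v + bvec b))) addr0 -pE.
move: (p - _) pE hr => r -> hr.
rewrite addrAC cE; apply: colour0_local => //.
pose c : {ffun 'I_d -> 'I_(m k)} := [ffun i => widen_ord (m_gt1 k) (b i)].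
by have -> : bvec b = bvec c by apply/rowP => i; rewrite !mxE ffunE.
Qed.

Lemma colour_dense w : exists p, inbox (corner 1 w) (side 1) p /\ colour 0 p = true.
Proof.
have [v [h1 h2]] := colour_block (k := 0) (fun=> true) w.
exists v; split; first by move: h1; rewrite {2}/corner /= mulr1n subr0.
have := h2 [ffun=> Ordinal (ltnW (m_gt1 0))].
by rewrite (_ : bvec _ = 0) ?addr0 //; apply/rowP => i; rewrite !mxE ffunE.
Qed.

Lemma colour_block_cnt k M (pi : {ffun 'I_d -> 'I_M} -> bool) : (M <= m k)%N ->
  exists o, forall c, cnt (colour 0) (o + bvec c *+ side k) (side k) = cell_cnt k (pi c).
Proof.
move=> Mm.
pose emb (c : {ffun 'I_d -> 'I_M}) : {ffun 'I_d -> 'I_(m k)} := [ffun i => widen_ord Mm (c i)].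
have embE c : bvec (emb c) = bvec c by apply/rowP => i; rewrite !mxE ffunE.
(* Extends [pi] to side [m k] by the colour [false]. *)
pose pi' c' := [exists c, (emb c == c') && pi c].
have [v [_ h]] := colour_block pi' 0.
exists (corner k v) => c; rewrite -corner_add cnt_cell -embE h.
congr cell_cnt; apply/existsP/idP => [[c0 /andP[/eqP e hc]]|hc].
  by rewrite -(_ : c0 = c) //; apply: bvec_inj; rewrite -!embE e.
by exists c; rewrite eqxx.
Qed.

(** Only subcells that inherit the colour of their parent contribute to the difference. The gap is 1
    at level 0 and keeps a factor 1 - x_k at each level; the product of these is at least 1 minus
    the sum. *)
Lemma cell_gap (x : nat -> R) :
  (forall k, #|[set a : {ffun 'I_d -> 'I_(n k)} |
                 rule k true (bvec a) == rule k false (bvec a)]|%:R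
             <= x k * (n k ^ d)%:R) ->
  (forall k, \sum_(j < k) x j <= 1) ->
  forall k, (1 - \sum_(j < k) x j) * (side k ^ d)%:R
    <= (cell_cnt k true)%:R - (cell_cnt k false)%:R.
Proof.
move=> hx sx; elim=> [|k IH].
  by rewrite big_ord0 /= exp1n; lra.
pose gap : R := (cell_cnt k true)%:R - (cell_cnt k false)%:R.
set A := [set a : {ffun 'I_d -> 'I_(n k)} | rule k true (bvec a) == rule k false (bvec a)].
have hxk := hx k; rewrite -/A in hxk.
have -> : (cell_cnt k.+1 true)%:R - (cell_cnt k.+1 false)%:R = #|~: A|%:R * gap :> R.
  rewrite /= !natr_sum -sumrB (bigID (mem (~: A))) /=.
  rewrite [X in _ + X]big1 ?addr0 => [|a]; last first.
    by rewrite !inE negbK => /eqP->; rewrite subrr.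
  rewrite (eq_bigr (fun=> gap)) => [|a]; first by rewrite sumr_const mulr_natl.
  by rewrite !inE => ha; rewrite !(rule_generic ha).
have KE : #|~: A|%:R = (n k ^ d)%:R - #|A|%:R :> R.
  by rewrite -card_box -(cardsC A) natrD addrC addKr.
have hA : (1 - x k) * (n k ^ d)%:R <= #|~: A|%:R.
  by rewrite KE mulrBl mul1r lerD2l lerN2 hxk.
have S0 : 0 <= 1 - \sum_(j < k) x j by rewrite subr_ge0.
have xs j : 0 <= x j.
  by have := le_trans (ler0n _ _) (hx j); rewrite pmulr_lge0 // ltr0n expn_gt0 n_gt0.
apply: le_trans (ler_wpM2l _ IH) => //.
rewrite big_ord_recr /= expnMn natrM.
have Ss : 0 <= \sum_(j < k) x j by apply: sumr_ge0 => j _; exact: xs.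
set S := \sum_(j < k) x j in S0 Ss *.
set z := (side k ^ d)%:R.
have z0 : 0 <= z :> R by [].
apply: le_trans (_ : (1 - x k) * (n k ^ d)%:R * ((1 - S) * z) <= _).
  have : 0 <= S * x k * ((n k ^ d)%:R * z) by rewrite !mulr_ge0.
  lra.
by apply: ler_wpM2r => //; exact: mulr_ge0.
Qed.

End Hierarchy.

(** * Dictionaries and choice of the scales *)

Section Dictionary.
Variables (d : nat) (i0 : 'I_d).
Local Notation P := 'rV[int]_d.
Local Notation e := (delta_mx 0 i0 : P).

Definition dict_size (m : nat) : nat := (2 ^ (m ^ d) * m ^ d)%N.

Let d_gt0 : (0 < d)%N. Proof. by apply: leq_ltn_trans (ltn_ord i0). Qed.

(** The blocks of side [m] are laid side by side along [i0], one for each pattern; every other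
    position keeps the colour of the parent. Hence the positions that ignore this colour are among
    the dictionary entries. *)
Lemma dictionary (m n : nat) : (2 < m)%N -> (dict_size m <= n)%N ->
  exists (rule : bool -> P -> bool) (q : P),
  [/\ forall i, (0 < q 0 i) && (q 0 i + 1 < n%:Z),
      forall b, rule b q = true,
      forall pi : {ffun 'I_d -> 'I_m} -> bool, exists u : P, forall b c,
        inbox 0 n (u + bvec c) /\ rule b (u + bvec c) = pi c,
      forall a, rule true a != rule false a -> forall b, rule b a = b &
      (#|[set a : {ffun 'I_d -> 'I_n} |
           rule true (bvec a) == rule false (bvec a)]| <= dict_size m)%N].
Proof.
move=> m2 mn.
have m0 : (0 < m)%N by apply: ltn_trans m2.
pose T := {ffun {ffun 'I_d -> 'I_m} -> bool}.
have cardT : #|{: T}| = (2 ^ (m ^ d))%N by rewrite card_ffun card_bool card_box.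
pose at_ (tc : T * {ffun 'I_d -> 'I_m}) : P :=
  e *+ (m * enum_rank tc.1) + bvec tc.2.
have atE tc i : at_ tc 0 i = if i == i0 then (m * enum_rank tc.1 + tc.2 i)%N%:Z else (tc.2 i)%:Z.
  rewrite mxE mulvnE !mxE eqxx /=.
  by case: (i == i0) => /=; rewrite ?mul1r ?mul0r ?add0r // PoszD.
have at_inj : injective at_.
  move=> [t c] [t' c'] /rowP h.
  have h0 := h i0; rewrite !atE eqxx in h0; case: h0 => h0.
  have tt' : t = t'.
    apply/enum_rank_inj/val_inj => /=.
    have := congr1 (divn^~ m) h0; rewrite ![(m * _)%N]mulnC /= !divnMDl //.
    by rewrite !divn_small ?addn0 ?ltn_ord.
  subst t'; congr pair; apply/ffunP => i; apply/val_inj => /=.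
  have := h i; rewrite !atE; case: (i == i0) => -[] //.
  by move/addnI.
pose rule b (x : P) : bool :=
  if [pick tc | x == at_ tc] is Some tc then tc.1 tc.2 else b.
have ruleE b tc : rule b (at_ tc) = tc.1 tc.2.
  rewrite /rule; case: pickP => [tc' /eqP/at_inj-> //|/(_ tc)].
  by rewrite eqxx.
have at_lt tc i : at_ tc 0 i < (m * 2 ^ (m ^ d))%N%:Z.
  rewrite atE; have h1 : (m * enum_rank tc.1 + m <= m * 2 ^ (m ^ d))%N.
    by rewrite -mulnSr leq_mul2l -cardT ltn_ord orbT.
  have := ltn_ord (tc.2 i); move: (enum_rank _ : nat) (tc.2 i : nat) h1 => a b h1 h2.
  by case: (i == i0); lia.
have mTn : (m * 2 ^ (m ^ d) <= n)%N.
  apply: leq_trans mn; rewrite mulnC leq_mul2l; apply/orP; right.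
  by case: (d) d_gt0 => // d' _; rewrite expnS leq_pmulr // expn_gt0 m0.
have z0 i : (0 : P) 0 i = 0 by rewrite mxE.
pose one : {ffun 'I_d -> 'I_m} := [ffun=> Ordinal (ltnW m2)].
pose two : {ffun 'I_d -> 'I_m} := [ffun=> Ordinal m2].
(* The centre is the point (1, ..., 1) of the block of the constant pattern [true]; as m > 2, its
   upper neighbour is still in that block, which keeps the centre off the faces. *)
exists rule, (at_ ([ffun=> true], one)); split.
- move=> i; have := at_lt ([ffun=> true], two) i; rewrite !atE !ffunE /=.
  move: (enum_rank _ : nat) (m * _)%N mTn => a b mTn.
  by move=> h; case: (i == i0) h => h; lia.
- by move=> b; rewrite ruleE ffunE.
- move=> pi; exists (e *+ (m * enum_rank (finfun pi : T))) => b c.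
  have -> : e *+ (m * enum_rank (finfun pi : T)) + bvec c = at_ (finfun pi, c) by [].
  rewrite ruleE ffunE; split=> //; apply/forallP => i; rewrite z0 add0r.
  have := at_lt (finfun pi, c) i; rewrite atE.
  by move: (m * 2 ^ _)%N mTn => y mTn; case: (i == i0); lia.
- by move=> a; rewrite /rule; case: pickP => // tc _; rewrite eqxx.
pose A := [set a : {ffun 'I_d -> 'I_n} | rule true (bvec a) == rule false (bvec a)].
pose f a := odflt ([ffun=> true], one) [pick tc | @bvec d n a == at_ tc].
have fE a : a \in A -> bvec a = at_ (f a).
  by rewrite inE /rule /f; case: pickP => [tc /eqP //|].
have f_inj : {in A &, injective f}.
  by move=> a a' aA a'A faa'; apply: bvec_inj; rewrite !fE // faa'.
rewrite -(card_in_imset f_inj); apply: leq_trans (max_card _) _.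
by rewrite card_prod cardT card_box.
Qed.


End Dictionary.

(** * Ratios of order k^(1/d) up to logarithms, and their summable waste *)

Section ScaleSequences.
Variables (R : realType) (d : nat).
Hypothesis d_gt1 : (1 < d)%N.

Definition level (k : nat) : nat := trunc_log 2 k.+1.
Let base : nat := dict_size d 3.
(** The rounded-up exponent makes scale(k)^d at least 2^(level k), about [k]; the power of the
    logarithm makes the waste summable. *)
Definition scale (k : nat) : nat := (2 ^ (level k %/ d).+1 * (level k + base) ^ 4)%N.
(** The largest pattern whose dictionary is logarithmic in [k]. It tends to infinity, and [base]
    guarantees that it is at least 3 from the start. *)
Definition pattern_size (k : nat) : nat :=
  \max_(j < (level k).+4 | (dict_size d j <= level k + base)%N) j.

Lemma base_ge : (3 <= base)%N.
Proof.
have d0 : (0 < d)%N by apply: ltnW.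
rewrite /base /dict_size; have h : (3 <= 3 ^ d)%N by rewrite -{1}(expn1 3) leq_exp2l.
apply: leq_trans h _; rewrite leq_pmull // expn_gt0 //.
Qed.

Lemma dict_size_pattern k : (dict_size d (pattern_size k) <= level k + base)%N.
Proof.
rewrite /pattern_size; elim/big_ind: _ => //.
- by rewrite /dict_size exp0n ?muln0 // ltnW.
- by move=> a b ha hb; rewrite /maxn; case: ltnP.
Qed.

Lemma pattern_size_ge k M : (M < (level k).+4)%N -> (dict_size d M <= level k + base)%N ->
  (M <= pattern_size k)%N.
Proof.
move=> hM hD; exact: (@leq_bigmax_cond _ _ (fun j : 'I_(level k).+4 => j : nat) (Ordinal hM)).
Qed.

Lemma pattern_size_ge3 k : (2 < pattern_size k)%N.
Proof. by apply: pattern_size_ge; rewrite // leq_addl. Qed.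

Lemma dict_size_scale k : (dict_size d (pattern_size k) <= scale k)%N.
Proof.
apply: leq_trans (dict_size_pattern k) _; rewrite /scale.
have b3 := base_ge; have y0 : (0 < level k + base)%N by lia.
apply: (@leq_trans ((level k + base) ^ 4)); last by rewrite leq_pmull // expn_gt0.
by rewrite -{1}[(level k + base)%N]expn1 leq_pexp2l.
Qed.

Lemma level_mono k k' : (k <= k')%N -> (level k <= level k')%N.
Proof. by move=> kk'; apply: leq_trunc_log. Qed.

Lemma scale_mono k k' : (k <= k')%N -> (scale k <= scale k')%N.
Proof.
move=> kk'; have h := level_mono kk'; rewrite /scale; apply: leq_mul.
  by rewrite leq_exp2l // ltnS leq_div2r.
by rewrite leq_exp2r // leq_add2r.
Qed.

Lemma level_bounds k : (2 ^ level k <= k.+1 < 2 ^ (level k).+1)%N.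
Proof. exact: trunc_log_bounds. Qed.

(* Chosen so that the total over the 2^i values of k with [level k = i] is
   1/2 (1/(i+1) - 1/(i+2)). *)
Definition waste (k : nat) : R :=
  (2 * (2 ^ level k)%:R * (level k).+1%:R * (level k).+2%:R)^-1.

(** With y = i + base, the power of two in scale(k)^d absorbs 2^i, and y^4 absorbs the dictionary
    size y together with the factor 2 (i + 1)(i + 2). *)
Lemma dict_waste k : (dict_size d (pattern_size k))%:R <= waste k * (scale k ^ d)%:R.
Proof.
apply: (@le_trans _ _ (level k + base)%:R); first by rewrite ler_nat dict_size_pattern.
rewrite /waste mulrC ler_pdivlMr ?mulr_gt0 ?ltr0n ?expn_gt0 // -!natrM ler_nat.
have b3 := base_ge; rewrite /scale; set i := level k; set y := (i + base)%N.
rewrite expnMn -!expnM.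
have h1 : (2 ^ i <= 2 ^ ((i %/ d).+1 * d))%N.
  by rewrite leq_exp2l //; apply/ltnW; rewrite -ltn_divLR // ltnW.
have y3 : (i.+2 <= y /\ 2 <= y /\ 0 < y)%N by lia.
have h2 : (y * (2 * i.+1 * i.+2) <= y ^ 4)%N.
  rewrite !expnS expn0 muln1 leq_mul2l; apply/orP; right; rewrite -mulnA.
  by apply: leq_mul; last apply: leq_mul; lia.
have h3 : (y ^ 4 <= y ^ (4 * d))%N by rewrite leq_pexp2l ?leq_pmulr //; lia.
apply: leq_trans (leq_mul h1 (leq_trans h2 h3)).
rewrite -!mulnA leq_eqVlt; apply/orP; left; apply/eqP; ring.
Qed.

Lemma sum_waste k : \sum_(j < k) waste j <= 2^-1.
Proof.
(* g interpolates 1/(2 (i+1)) at k + 1 = 2^i linearly in k. *)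
pose g (k : nat) : R := let i := level k in let r : R := k.+1%:R / (2 ^ i)%:R - 1 in
  2^-1 * (i.+1%:R^-1 - r * (i.+1%:R^-1 - i.+2%:R^-1)).
have g0 j : 0 <= g j.
  have /andP[h1 h2] := level_bounds j; rewrite /g; set i := level j in h1 h2 *.
  apply: mulr_ge0 => //; rewrite subr_ge0.
  have p0 : 0 < (2 ^ i)%:R :> R by rewrite ltr0n expn_gt0.
  have r1 : j.+1%:R / (2 ^ i)%:R - 1 <= 1 :> R.
    by rewrite lerBlDr ler_pdivrMr // -[1 + 1]/(2%:R) -natrM ler_nat -expnS ltnW.
  have c0 : 0 <= i.+1%:R^-1 - i.+2%:R^-1 :> R.
    by rewrite subr_ge0 lef_pV2 ?posrE ?ltr0n // ler_nat.
  apply: le_trans (ler_wpM2r c0 r1) _; rewrite mul1r lerBlDr lerDl invr_ge0 //.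
suff h : \sum_(j < k) waste j = 2^-1 - g k by rewrite h; have := g0 k; lra.
elim: k => [|k IH].
  rewrite big_ord0 /g /level /= trunc_log1 expn0; by field.
rewrite big_ord_recr /= IH /waste.
have /andP[h1 h2] := level_bounds k; have /andP[h3 h4] := level_bounds k.+1.
have p0 : (2 ^ level k)%:R != 0 :> R by rewrite pnatr_eq0 expn_eq0.
(* The summand is exactly g k - g (k + 1): either both indices lie on one linear piece of [g], or k
   + 2 is the power of two where the next piece starts. *)
have [e|e] : level k.+1 = level k \/ (level k.+1 = (level k).+1 /\ k.+2 = 2 ^ (level k).+1)%N.
- have le1 := level_mono (leqnSn k).
  have [lt1|ge1] := ltnP k.+2 (2 ^ (level k).+1)%N.
    left; apply/eqP; rewrite eqn_leq le1 andbT -ltnS.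
    by rewrite -(ltn_exp2l _ _ (isT : 1 < 2)%N) (leq_ltn_trans h3).
  have e2 : k.+2 = (2 ^ (level k).+1)%N by apply/eqP; rewrite eqn_leq ge1 andbT.
  by right; split=> //; rewrite /level e2 trunc_expnK.
- rewrite /g e -[k.+2%:R]natr1; set i := level k in p0 *.
  rewrite -[i.+2%:R]natr1 -[i.+1%:R]natr1; have := ler0n R i.
  move: ((2 ^ i)%:R : R) (k.+1%:R : R) (i%:R : R) p0 => p y z p0 z0; field.
  by rewrite p0 /= !gt_eqF //; lra.
case: e => e1 e2; rewrite /g e1 e2 divff ?pnatr_eq0 ?expn_eq0 //.
have -> : k.+1%:R = 2 * (2 ^ level k)%:R - 1 :> R.
  by rewrite -natrM -expnS -e2 -[k.+2%:R]natr1; lra.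
set i := level k in p0 *; rewrite -[i.+3%:R]natr1 -[i.+2%:R]natr1 -[i.+1%:R]natr1.
have := ler0n R i; move: ((2 ^ i)%:R : R) (i%:R : R) p0 => p z p0 z0; field.
by rewrite p0 /= !gt_eqF //; lra.
Qed.

End ScaleSequences.

(** * Growth of the scales *)

Section Growth.
Variable R : realType.

(** The tangent of [ln] at [x] gives x ln y <= x ln x + y - x, which is at most y ln x because ln x
    >= 1. *)
Lemma div_ln_mono (x y : R) : expR 1 <= x -> x <= y -> x / ln x <= y / ln y.
Proof.
move=> ex xy.
have x0 : 0 < x by apply: lt_le_trans ex; exact: expR_gt0.
have y0 : 0 < y by apply: lt_le_trans xy.
have lx : 1 <= ln x by rewrite -[leLHS]expRK ler_ln ?posrE ?expR_gt0.
have ly : ln y <= ln x + (y / x - 1).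
  have yx0 : 0 < y / x by rewrite divr_gt0.
  rewrite -[in leLHS](divfK (lt0r_neq0 x0) y) lnM ?posrE // addrC lerD2l.
  have := expR_ge1Dx (ln (y / x)); rewrite lnK ?posrE //; lra.
have lxp : 0 < ln x by apply: lt_le_trans lx.
have lyp : 0 < ln y by apply: lt_le_trans lxp _; rewrite ler_ln ?posrE.
rewrite ler_pdivrMr // mulrAC ler_pdivlMr //.
apply: le_trans (ler_wpM2l (ltW x0) ly) _.
have -> : x * (ln x + (y / x - 1)) = x * ln x + y - x by field; rewrite gt_eqF.
have : 0 <= (y - x) * (ln x - 1) by rewrite mulr_ge0 ?subr_ge0.
lra.
Qed.

(** The exponential dominates (a i / 9)^9, one degree above the polynomial. The exponent 8 is that
    of the logarithms in a squared scale. *)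
Lemma poly_exp_decay (a b eps : R) : 0 < a -> 0 <= b -> 0 < eps ->
  exists i1 : nat, forall i : nat, (i1 <= i)%N ->
    (i%:R + b) ^+ 8 * expR (- (a * i%:R)) <= eps.
Proof.
move=> a0 b0 eps0.
pose c := (a / 9) ^+ 9 / 2 ^+ 8.
have c0 : 0 < c by rewrite divr_gt0 ?exprn_gt0 ?divr_gt0.
exists (Num.truncn (b + (c * eps)^-1)).+1 => i hi.
have ib : b + (c * eps)^-1 < i%:R.
  by apply: lt_le_trans (truncnS_gt _) _; rewrite ler_nat.
have ce0 : 0 < (c * eps)^-1 by rewrite invr_gt0 mulr_gt0.
have i0 : 0 < i%:R :> R by lra.
have h1 : (i%:R + b) ^+ 8 <= (2 * i%:R) ^+ 8.
  by rewrite ler_pXn2r ?nnegrE ?addr_ge0 ?mulr_ge0 //; lra.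
have h2 : (a * i%:R / 9) ^+ 9 <= expR (a * i%:R).
  have -> : expR (a * i%:R) = expR (a * i%:R / 9) ^+ 9.
    by rewrite -expRM_natl; congr expR; field.
  have z0 : 0 <= a * i%:R / 9 by rewrite !mulr_ge0 // ltW.
  rewrite ler_pXn2r ?nnegrE ?expR_ge0 //.
  by apply: le_trans (expR_ge1Dx _); rewrite lerDr.
rewrite expRN -ler_pdivlMr ?invr_gt0 ?expR_gt0 // invrK.
apply: le_trans h1 _; apply: le_trans (ler_wpM2l (ltW eps0) h2).
have h3 : 1 <= c * eps * i%:R.
  by rewrite mulrC -ler_pdivrMr ?mulr_gt0 // mul1r; lra.
have -> : eps * (a * i%:R / 9) ^+ 9 = (2 * i%:R) ^+ 8 * (c * eps * i%:R).
  by rewrite /c; field.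
by rewrite ler_peMr // exprn_ge0 // mulr_ge0.
Qed.

Variable d : nat.
Hypothesis d_gt1 : (1 < d)%N.

Let ln2_gt0 : 0 < ln 2 :> R. Proof. by rewrite ln_gt0 // ltr1n. Qed.
Let ln2_le1 : ln 2 <= 1 :> R.
Proof. by have := @le_ln1Dx R 1; rewrite -[1 + 1]/(2%:R); apply; lra. Qed.

Let natpow t : (2 ^ t)%:R = expR (t%:R * ln 2) :> R.
Proof. by rewrite expRM_natl lnK ?posrE // natrX. Qed.

Lemma side_ge_pow (n : nat -> nat) (a c k : nat) :
  (forall j, (0 < n j)%N) -> (forall j, (a <= j)%N -> (c <= n j)%N) -> (0 < c)%N ->
  (c ^ (k - a) <= side n k)%N.
Proof.
move=> n0 hn c0; elim: k => [//|k IH].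
have [ak|ka] := leqP a k; last first.
  rewrite (_ : k.+1 - a = 0)%N; last by apply/eqP; rewrite subn_eq0.
  exact: (side_gt0 n0 k.+1).
by rewrite subSn // expnS /=; apply: leq_mul => //; apply: hn.
Qed.

(** At least 2^(i-2) of the ratios multiplied in the side have level at least i - 1. Their
    logarithmic factors supply a spare 2, which later cancels the one in [side < 2 * r]. *)
Lemma side_scale_lower i k : (1 < i)%N -> (2 ^ i <= k.+2)%N ->
  (2 * (2 ^ (i.-1 %/ d).+1) ^ (2 ^ i.-2) <= side (scale d) k)%N.
Proof.
case: i => [//|[//|i]] _ /= hk.
set X := (2 ^ (i.+1 %/ d).+1)%N.
have X0 : (0 < X)%N by rewrite expn_gt0.
have b3 := base_ge d_gt1.
have n0 j : (0 < scale d j)%N by rewrite /scale muln_gt0 !expn_gt0 /=; apply/orP; left; lia.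
apply: (@leq_trans ((2 * X) ^ (k - (2 ^ i.+1).-1))); last first.
  apply: side_ge_pow => // [j hj|]; last by rewrite muln_gt0 X0.
  have hl : (i.+1 <= level j)%N.
    by rewrite /level trunc_log_max // -(prednK (expn_gt0 2 i.+1)) ltnS.
  rewrite /scale mulnC; apply: leq_mul.
    by rewrite leq_exp2l // ltnS leq_div2r.
  rewrite !expnS expn0; nia.
have e1 : (2 ^ i <= k - (2 ^ i.+1).-1)%N.
  have : (0 < 2 ^ i)%N by rewrite expn_gt0.
  move: hk; rewrite !expnS; lia.
apply: leq_trans (leq_pexp2l _ e1); last by rewrite muln_gt0 X0.
rewrite expnMn leq_mul2r; apply/orP; right.
by rewrite -{1}[2%N]expn1 leq_exp2l // expn_gt0.
Qed.

(** The bound on the side gives ln r >= y0 = c1 2^i i, while ln y0 <= 2 i; monotonicity of x / ln x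
    then compares the quotients. *)
Lemma ln_ratio_lower : exists2 c : R, 0 < c & exists i1 : nat,
  forall i k r, (i1 <= i)%N -> (2 ^ i <= k.+2)%N -> (side (scale d) k)%:R < 2 * r ->
    c * (2 ^ i)%:R <= ln r / ln (ln r).
Proof.
have d0 : 0 < d%:R :> R by rewrite ltr0n ltnW.
have d1 : 1 <= d%:R :> R by rewrite ler1n ltnW.
pose c1 : R := ln 2 / (4 * d%:R).
have c10 : 0 < c1 by rewrite divr_gt0 ?mulr_gt0.
have c11 : c1 <= 1.
  rewrite /c1 ler_pdivrMr ?mulr_gt0 // mul1r; have := ln2_le1; lra.
exists (c1 / 2); first by rewrite divr_gt0.
exists (Num.truncn (expR 1 / c1)).+2 => i k r hi hk hr.
have i2 : (1 < i)%N by apply: leq_trans hi.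
have i0 : 0 < i%:R :> R by rewrite ltr0n ltnW.
pose X : nat := (2 ^ (i.-1 %/ d).+1)%N.
have X0 : 0 < X%:R :> R by rewrite ltr0n expn_gt0.
have Xr : X%:R ^+ (2 ^ i.-2) < r.
  have := side_scale_lower i2 hk; rewrite -(ler_nat R) natrM natrX -/X; lra.
have r0 : 0 < r by apply: lt_trans Xr; rewrite exprn_gt0.
pose y0 : R := c1 * (2 ^ i)%:R * i%:R.
have y0r : y0 <= ln r.
  apply: (@le_trans _ _ (ln (X%:R ^+ (2 ^ i.-2)))); last first.
    by rewrite ler_ln ?posrE ?exprn_gt0 // ltW.
  rewrite lnXn // /X natrX lnXn // -!mulrnA -[leRHS]mulr_natl.
  have h1 : (i <= (i.-1 %/ d).+1 * d)%N.
    by rewrite -[X in (X <= _)%N](prednK (ltnW i2)) -ltn_divLR // ltnW.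
  have h2 : (2 ^ i = 4 * 2 ^ i.-2)%N by case: (i) i2 => [|[|j]] // _; rewrite !expnS mulnA.
  rewrite /y0 /c1 h2 !natrM.
  have -> : ln 2 / (4 * d%:R) * (4 * (2 ^ i.-2)%:R) * i%:R
     = (2 ^ i.-2)%:R * (i%:R / d%:R) * ln 2 :> R by field; rewrite gt_eqF.
  rewrite ler_pM2r // [leRHS]mulrC ler_pM2l ?ltr0n ?expn_gt0 //.
  by rewrite ler_pdivrMr // -natrM ler_nat.
have p2 : 1 <= (2 ^ i)%:R :> R by rewrite ler1n expn_gt0.
have ey0 : expR 1 <= y0.
  have h : expR 1 / c1 < i%:R.
    by apply: lt_le_trans (truncnS_gt _) _; rewrite ler_nat ltnW.
  rewrite ltr_pdivrMr // in h; apply/ltW/(lt_le_trans h).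
  have : 0 <= i%:R * c1 * ((2 ^ i)%:R - 1) by rewrite !mulr_ge0 ?subr_ge0 // ltW.
  rewrite /y0; lra.
apply: le_trans (div_ln_mono ey0 y0r).
have y00 : 0 < y0 by apply: lt_le_trans ey0; exact: expR_gt0.
have ln1 : 1 <= ln y0 by rewrite -[leLHS]expRK ler_ln ?posrE ?expR_gt0.
have lny : ln y0 <= 2 * i%:R.
  apply: (@le_trans _ _ (ln ((2 ^ i)%:R * (2 ^ i)%:R))).
    have p0 : 0 < (2 ^ i)%:R :> R by apply: lt_le_trans p2.
    have pp : 0 < (2 ^ i)%:R * (2 ^ i)%:R :> R by rewrite mulr_gt0.
    rewrite ler_ln ?posrE //.
    apply: (@le_trans _ _ (1 * (2 ^ i)%:R * i%:R)).
      by rewrite /y0 !ler_pM2r // ltr0n expn_gt0.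
    by rewrite mul1r ler_wpM2l // ler_nat ltnW // ltn_expl.
  rewrite lnM ?posrE ?ltr0n ?expn_gt0 // natrX lnXn // -[ln 2 *+ i]mulr_natl.
  have : i%:R * ln 2 <= i%:R :> R by rewrite ler_piMr // ltW.
  lra.
have lnp : 0 < ln y0 by apply: lt_le_trans ln1.
rewrite ler_pdivlMr //; apply: le_trans (ler_wpM2l _ lny) _.
  by rewrite !mulr_ge0 // ltW.
by rewrite /y0 le_eqVlt; apply/orP; left; apply/eqP; field.
Qed.

(** Two ratios separate levels [k] and k + 2, contributing 2^(2i/d) times a polynomial in [i], while
    the denominator contributes 2^(q i); since q > 2/d the quotient decays exponentially in [i]. *)
Lemma repetitivity_ratio_small (A q eps : R) : 0 < A -> 2 / d%:R < q -> 0 < eps ->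
  exists i1 : nat, forall k r, (i1 <= level k.+1)%N ->
    (side (scale d) k)%:R < 2 * r ->
    A * (side (scale d) k.+2)%:R / (r * (ln r / ln (ln r)) `^ q) <= eps.
Proof.
move=> A0 hq eps0.
have d0 : 0 < d%:R :> R by rewrite ltr0n ltnW.
have q0 : 0 < q by apply: lt_trans hq; rewrite divr_gt0.
have [c c0 [i1 hc]] := ln_ratio_lower.
pose a : R := (q - 2 / d%:R) * ln 2.
have a0 : 0 < a by rewrite mulr_gt0 // subr_gt0.
pose base : nat := dict_size d 3.
pose B : R := 8 * A / c `^ q.
have cq : 0 < c `^ q by rewrite powR_gt0.
have B0 : 0 < B by rewrite divr_gt0 ?mulr_gt0.
have [i2 hi2] := @poly_exp_decay a base%:R (eps / B) a0 (ler0n _ _) (divr_gt0 eps0 B0).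
exists (maxn i1 i2) => k r; rewrite geq_max; set i := level k.+1 => /andP[i1i i2i] hr.
have /andP[ik _] := level_bounds k.+1; rewrite -/i in ik.
have := hc i k r i1i ik hr; set y := ln r / _ => hy.
have r0 : 0 < r.
  have : 0 <= (side (scale d) k)%:R :> R by [].
  lra.
have p0 : 0 < (2 ^ i)%:R :> R by rewrite ltr0n expn_gt0.
have yq : c `^ q * expR (q * (i%:R * ln 2)) <= y `^ q.
  apply: (@le_trans _ _ ((c * (2 ^ i)%:R) `^ q)); last first.
    have cp : 0 <= c * (2 ^ i)%:R by rewrite mulr_ge0 // ltW.
    by apply: (ge0_ler_powR (ltW q0)); rewrite ?nnegrE // (le_trans cp).
  rewrite powRM //; last exact: ltW.
  rewrite ler_pM2l //.
  by rewrite /powR gt_eqF // natpow expRK.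
have yq0 : 0 < y `^ q by apply: lt_le_trans yq; rewrite mulr_gt0 ?expR_gt0.
have nle : (side (scale d) k.+2)%:R <= (scale d k.+1)%:R ^+ 2 * (2 * r).
  have -> : side (scale d) k.+2 = (scale d k.+1 * (scale d k * side (scale d) k))%N by [].
  rewrite natrM [(scale d k * _)%:R]natrM expr2 -[leRHS]mulrA; apply: ler_wpM2l => //.
  apply: ler_pM => //; last exact: ltW.
  by rewrite ler_nat scale_mono.
have sE :
    (scale d k.+1)%:R ^+ 2 <= (4 : R) * (i%:R + base%:R) ^+ 8 * expR (2 / d%:R * (i%:R * ln 2)).
  pose t := (i %/ d)%N; set x : R := i%:R + base%:R; pose z := x ^+ 4.
  have -> : (scale d k.+1)%:R = 2 * ((2 ^ t)%:R * z).
    by rewrite /z /x -natrD -natrX -!natrM /scale -/i -/base expnS mulnA.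
  have -> : (2 * ((2 ^ t)%:R * z)) ^+ 2 = 4 * z ^+ 2 * ((2 ^ t)%:R * (2 ^ t)%:R) :> R by ring.
  have -> : x ^+ 8 = z ^+ 2 by rewrite /z -exprM.
  apply: ler_wpM2l; first by rewrite mulr_ge0 // sqr_ge0.
  rewrite natpow -expRD ler_expR -mulrDl mulrA ler_pM2r //.
  have : t%:R <= i%:R / d%:R :> R by rewrite ler_pdivlMr // -natrM ler_nat leq_divM.
  lra.
have hE : 8 * A * ((i%:R + base%:R) ^+ 8 * expR (2 / d%:R * (i%:R * ln 2))) <= eps * y `^ q.
  apply: le_trans (ler_wpM2l (ltW eps0) yq).
  have -> : expR (2 / d%:R * (i%:R * ln 2)) = expR (- (a * i%:R)) * expR (q * (i%:R * ln 2)) :> R.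
    by rewrite -expRD; congr expR; rewrite /a; ring.
  have hz : 8 * A * ((i%:R + base%:R) ^+ 8 * expR (- (a * i%:R))) <= eps * c `^ q.
    have := ler_wpM2l (ltW B0) (hi2 i i2i).
    rewrite [B * (eps / B)]mulrC divfK ?gt_eqF // /B mulrAC ler_pdivrMr //.
  rewrite [leRHS]mulrA [_ ^+ 8 * _]mulrA mulrA; apply: ler_wpM2r => //; exact: expR_ge0.
rewrite ler_pdivrMr ?mulr_gt0 //.
apply: le_trans (ler_wpM2l (ltW A0) nle) _.
have h1 := ler_wpM2l (ltW A0) sE.
have h2 : 2 * (A * (scale d k.+1)%:R ^+ 2) <= eps * y `^ q by lra.
have := ler_wpM2l (ltW r0) h2; lra.
Qed.

End Growth.

Local Open Scope classical_set_scope.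
Local Open Scope ring_scope.

(** * Sets of integer points *)

(* The names [edist] and [patch] of Defs are shadowed by library constants. *)
Section IntegerSets.
Variables (R : realType) (d : nat).
Local Notation P := 'rV[int]_d.
Implicit Types (Y : pred P) (p q : P).

Definition lattice_set Y : set 'rV[R]_d := [set x | exists2 p, Y p & x = ipt R p].

Definition vfloor (x : 'rV[R]_d) : P := \row_i Num.floor (x 0 i).

Lemma vfloor_dist (x : 'rV[R]_d) i : 0 <= x 0 i - (vfloor x 0 i)%:~R < 1.
Proof.
rewrite mxE subr_ge0 floor_le ltrBlDr addrC -(intrD _ _ 1).
by have := floorD1_gt (x 0 i).
Qed.

Lemma vfloor_near (x : 'rV[R]_d) : enorm (x - ipt R (vfloor x)) <= d%:R.
Proof.
rewrite -[leRHS]mulr1; apply: enorm_le_coord => // i; rewrite !mxE.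
have := vfloor_dist x i; rewrite mxE => /andP[z0 z1].
by rewrite ger0_norm // ltW.
Qed.

Lemma inrm_lt1 p : inrm R p < 1 -> p = 0.
Proof.
move=> p1; apply/rowP => i; rewrite mxE.
have := le_lt_trans (inrm_coord R p i) p1.
rewrite -[1]/(1%:~R) ltr_int => h; apply/eqP; rewrite -normr_le0.
by move: (`|_|) h => z; lia.
Qed.

Lemma lattice_set_uniformly_discrete Y : uniformly_discrete (lattice_set Y).
Proof.
exists 2^-1 => // c x y [[p _ ->] hp] [[q _ ->] hq].
congr ipt; apply/eqP; rewrite -subr_eq0; apply/eqP/inrm_lt1.
rewrite /inrm iptB; apply: le_lt_trans (enorm_tri c _ _) _.
move: hp hq; rewrite /eball /Defs.edist /= => hp hq.
rewrite [X in X + _]enormB; lra.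
Qed.

Lemma lattice_set_discrete Y : discrete_set (lattice_set Y).
Proof.
move=> x [p Yp ->]; split; first by rewrite inE; exists p.
exists (ball (ipt R p) 1); first exact: nbhsx_ballx.
apply/seteqP; split => [y [hy [q Yq yE]]|y ->]; last first.
  by split; [exact: ballxx | exists p].
rewrite /= yE; congr ipt; apply/rowP => i.
have [_ /(_ 0 i)] := hy.
rewrite -ball_normE /= yE !iptE -intrB -intr_norm -[1]/(1%:~R) ltr_int.
by move: (p 0 i) (q 0 i) => a b; lia.
Qed.

Lemma lattice_set_Delone Y (B : R) :
  (forall p, exists2 q, Y q & inrm R (q - p) <= B) -> Delone (lattice_set Y).
Proof.
move=> hB; split; [exact: lattice_set_discrete|exact: lattice_set_uniformly_discrete|].
have B0 : 0 <= B.
  by have [q _] := hB 0; apply: le_trans; exact: inrm_ge0.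
exists (B + d%:R + 1) => [|c]; first by rewrite ltr_wpDl // addr_ge0.
have [q Yq hq] := hB (vfloor c).
exists (ipt R q); split; first by exists q.
rewrite /eball /Defs.edist /=; apply: le_lt_trans (enorm_tri (ipt R (vfloor c)) _ _) _.
have h := vfloor_near c; rewrite -iptB -/(inrm R _) [inrm R _]inrmB; lra.
Qed.

(** [F] applies [f] to a point [nr p] of [Y] within [B] of [p]. Requiring [nr p = p] on [Y] makes
    [F] injective there; replacing points by nearby ones accounts for the additive constant. *)
Lemma lattice_set_coarse Y (B : R) : (forall p, exists2 q, Y q & inrm R (q - p) <= B) ->
  rectifiable (lattice_set Y) ->
  exists L C F G, [/\ 1 <= L, 0 <= C & @coarse_bilipschitz R d L C Y F G].
Proof.
move=> hB [f [[f_fun f_inj f_surj] [g [gK [L L0 [Lf Lg]]]]]].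
have B0 : 0 <= B.
  by have [q _] := hB 0; apply: le_trans; exact: inrm_ge0.
have /choice[nr hnr] : forall p, exists q,
    [/\ Y q, inrm R (q - p) <= B & Y p -> q = p].
  move=> p; have [q Yq hq] := hB p.
  have [Yp|nYp] := boolP (Y p); last by exists q; split.
  by exists p; split; rewrite // subrr inrm0.
have /choice[G hG] : forall q, exists p, Y p /\ f (ipt R p) = ipt R q.
  move=> q.
  have [|x [p Yp ->] fx] := f_surj (ipt R q); first by move=> i; rewrite iptE intr_int.
  by exists p.
have /choice[F hF] : forall p, exists q, f (ipt R (nr p)) = ipt R q.
  move=> p; have [Yp _ _] := hnr p.
  have fz : forall i, f (ipt R (nr p)) 0 i \is a Num.int by apply: f_fun; exists (nr p).
  exists (vfloor (f (ipt R (nr p)))); apply/rowP => i.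
  by rewrite iptE mxE floorK.
pose L' := Num.max L 1.
have L'0 : 0 <= L' by rewrite le_max ler01 orbT.
have LL' : L <= L' by rewrite le_max lexx.
exists L', (2 * L' * B + B), F, G; split; first by rewrite le_max lexx orbT.
  by rewrite addr_ge0 ?mulr_ge0.
have Yin p : Y p -> lattice_set Y (ipt R p) by move=> Yp; exists p.
split.
- move=> p q; rewrite /inrm iptB -!hF.
  have [Yp hp _] := hnr p; have [Yq hq _] := hnr q.
  apply: le_trans (Lf _ _ (Yin _ Yp) (Yin _ Yq)) _.
  rewrite /Defs.edist -iptB -!/(inrm R _).
  have h : inrm R (nr p - nr q) <= inrm R (p - q) + 2 * B.
    apply: le_trans (inrm_tri _ p _ _) _.
    apply: le_trans (lerD hp (inrm_tri _ q _ _)) _.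
    rewrite [inrm R (q - _)]inrmB; lra.
  apply: le_trans (ler_wpM2r (inrm_ge0 _ _) LL') _.
  apply: le_trans (ler_wpM2l L'0 h) _; lra.
- move=> q p; have [Yp hp _] := hnr p; have [YG fG] := hG q.
  apply: le_trans (inrm_tri _ (nr p) _ _) _.
  have h : inrm R (G q - nr p) <= L' * inrm R (q - F p).
    rewrite /inrm !iptB -(gK (ipt R (G q))) ?inE; last exact: Yin.
    rewrite -(gK (ipt R (nr p))) ?inE; last exact: Yin.
    rewrite fG hF.
    apply: le_trans (Lg _ _ _ _) _; try by move=> i; rewrite iptE intr_int.
    by apply: ler_wpM2r => //; exact: enorm_ge0.
  have : 0 <= 2 * L' * B by rewrite !mulr_ge0.
  lra.
- by move=> q; case: (hG q).
- move=> q q' qq'; apply: (@ipt_inj R).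
  by have [_ <-] := hG q; have [_ <-] := hG q'; rewrite qq'.
- move=> p q Yp Yq FF; have [_ _ /(_ Yp) np] := hnr p; have [_ _ /(_ Yq) nq] := hnr q.
  apply: (@ipt_inj R); apply: f_inj; rewrite ?inE; try exact: Yin.
  by rewrite -{1}np -{1}nq !hF FF.
Qed.

Lemma lattice_set_recurrent Y (side : nat -> nat) (corner : nat -> P -> P) (k : nat)
    (r : R) (x y : 'rV[R]_d) :
  (forall k p, exists v, inbox (corner k v) (side k) p) ->
  (forall v w, exists t,
    (forall p, inbox (corner k v) (2 * side k) p -> Y (p + t) = Y p) /\
    inbox (corner k.+1 w) (side k.+1) (corner k v + t)) ->
  (side k <= side k.+1)%N -> (0 < side k.+1)%N ->
  0 < r -> lattice_set Y x -> 2 * r <= (side k)%:R ->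
  exists2 z, patch_translate (lattice_set Y) r x z &
    Defs.patch (lattice_set Y) z r `&` eball y ((4 * d%:R + 1) * (side k.+1)%:R) !=set0.
Proof.
move=> in_cell recur ss s0 r0 [p0 Yp0 xE] hr.
(* The cell [v] is chosen to contain [p0] moved back by half a side, so that the ball of radius r <=
   side / 2 around [p0] fits in the 2^d-block at [v]. *)
pose a := (side k %/ 2)%N.
have [v hv] := in_cell k (p0 - const_mx a%:Z).
have [w hw] := in_cell k.+1 (vfloor y).
have [t [ht1 ht2]] := recur v w.
have near0 p : Defs.edist (ipt R p) x < r -> inbox (corner k v) (2 * side k) p.
  rewrite xE /Defs.edist -iptB -/(inrm R _) => hp; apply/forallP => i.
  have := le_lt_trans (inrm_coord R _ i) hp => {}hp.
  have {}hp : 2 * `|(p - p0) 0 i| < (side k)%:Z.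
    rewrite -(ltr_int R) intrM; apply: lt_le_trans hr.
    by rewrite ltr_pM2l.
  have := forallP hv i; rewrite !mxE in hp *.
  rewrite /a; move: hp; move: (p 0 i) (p0 0 i) (corner k v 0 i) (side k) => b c e s; lia.
have x_near : inbox (corner k v) (2 * side k) p0.
  by apply: near0; rewrite xE /Defs.edist subrr enorm0.
exists (ipt R (p0 + t)).
  split; first by exists (p0 + t); rewrite // ht1.
  have zx : ipt R (p0 + t) - x = ipt R t by rewrite xE -iptB addrC addKr.
  rewrite zx; apply/seteqP; split => [u [[p Yp ->] hp]|u [_ [[p Yp ->] hp] <-]].
    have hp' : Defs.edist (ipt R (p - t)) x < r.
      move: hp; rewrite /eball /= /Defs.edist xE enormB -!iptB.
      by rewrite opprD addrA [p - p0 - t]addrAC.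
    exists (ipt R (p - t)); last by rewrite -iptD addrC subrK.
    split; last by rewrite /eball /= /Defs.edist enormB.
    exists (p - t) => //.
    by rewrite -(ht1 _ (near0 _ hp')) subrK.
  move: (hp); rewrite /eball /= /Defs.edist => hp'; split.
    by exists (t + p); rewrite ?iptD // addrC ht1 //; apply: near0; rewrite /Defs.edist enormB.
  by rewrite /eball /= /Defs.edist iptD [ipt R t + _]addrC opprD addrACA subrr addr0 -xE.
exists (ipt R (p0 + t)); split.
  split; first by exists (p0 + t); rewrite // ht1.
  by rewrite /eball /= /Defs.edist subrr enorm0.
rewrite /eball /= /Defs.edist.
set s := side k.+1 in ss s0 ht2 hw *.
(* One side for the cell [w] and two for the block give 3 s per coordinate; rounding [y] adds at
   most d <= d s, and the extra 1 in 4 d + 1 makes the bound strict. *)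
have h1 : forall i, `|(vfloor y - (p0 + t)) 0 i| <= (3 * s)%N%:Z.
  move=> i; have := forallP ht2 i; have := forallP hw i; have := forallP x_near i.
  rewrite !mxE; move: (corner k v 0 i) (corner k.+1 w 0 i) (side k) ss => c e s' ss.
  move: (p0 0 i) (t 0 i) (Num.floor _) => x1 x2 x3; lia.
have h2 := vfloor_near y.
apply: le_lt_trans (enorm_tri (ipt R (vfloor y)) _ _) _.
have := inrm_le_coord R h1; rewrite /inrm iptB natrM => h3.
have s1 : 1 <= s%:R :> R by rewrite ler1n.
have : 0 <= d%:R * (s%:R - 1) :> R by rewrite mulr_ge0 // subr_ge0.
lra.
Qed.

End IntegerSets.

(** * Assembly of the set and of its repetitivity function *)

Theorem theorem1p5 (R : realType) (d : nat) (hd : (2 <= d)%N) :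
  exists X : set 'rV[R]_d,
    [/\ Delone X, ~ rectifiable X, repetitive X &
     exists2 rho : R -> R, repetitivity_function X rho &
       forall q : R, 2 / d%:R < q ->
         rho r / (r * (ln r / ln (ln r)) `^ q) @[r --> +oo] --> (0 : R)].
Proof.
pose i0 : 'I_d := Ordinal (ltnW hd); pose i1 : 'I_d := Ordinal hd.
pose n := scale d; pose m := pattern_size d.
have /choice[rq hrq] : forall k, exists rq : (bool -> 'rV[int]_d -> bool) * 'rV[int]_d,
  [/\ forall i, (0 < rq.2 0 i) && (rq.2 0 i + 1 < (n k)%:Z),
      forall b, rq.1 b rq.2 = true,
      forall pi : {ffun 'I_d -> 'I_(m k)} -> bool, exists u, forall b c,
        inbox 0 (n k) (u + bvec c) /\ rq.1 b (u + bvec c) = pi c,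
      forall a, rq.1 true a != rq.1 false a -> forall b, rq.1 b a = b &
      (#|finset (fun a : {ffun 'I_d -> 'I_(n k)} =>
           rq.1 true (bvec a) == rq.1 false (bvec a))| <= dict_size d (m k))%N].
  move=> k; have [rule [q h]] := dictionary i0 (pattern_size_ge3 d k) (dict_size_scale hd k).
  by exists (rule, q).
pose rule k := (rq k).1; pose q k := (rq k).2.
have q_bounds k i : (0 < q k 0 i) && (q k 0 i + 1 < (n k)%:Z) by have [] := hrq k.
have rule_centre k b : rule k b (q k) = true by have [_ h _ _ _] := hrq k; exact: h.
have rule_universal k (pi : {ffun 'I_d -> 'I_(m k)} -> bool) : exists u, forall b c,
    inbox 0 (n k) (u + bvec c) /\ rule k b (u + bvec c) = pi c by have [] := hrq k.
have rule_generic k a : rule k true a != rule k false a -> forall b, rule k b a = b.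
  by have [_ _ _ h _] := hrq k; exact: h.
have n_gt1 k : (1 < n k)%N.
  by have := q_bounds k i0; move: (q k 0 i0) => z; lia.
have n_gt0 k : (0 < n k)%N by apply: ltnW.
have m_gt1 k : (1 < m k)%N by apply: ltnW; exact: pattern_size_ge3.
pose S := side n.
have S_gt0 k : (0 < S k)%N by exact: side_gt0.
have S_ge k : (k <= S k)%N.
  have := @side_ge_pow n 0 2 k n_gt0 (fun j _ => n_gt1 j) isT.
  by rewrite subn0; apply: leq_trans; apply/ltnW/ltn_expl.
have S_mono k k' : (k <= k')%N -> (S k <= S k')%N.
  move=> /subnK <-; elim: (k' - k)%N => // j IH.
  by apply: leq_trans IH _; rewrite /S addSn /= leq_pmull.
pose Y : pred 'rV[int]_d := colour n q rule 0.
have Y_dense p : exists2 p', Y p' & inrm R (p' - p) <= d%:R * (S 1)%:R.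
  have [w hw] := in_cell q n_gt0 1 p.
  have [p' [hp' Yp']] := colour_dense n_gt0 m_gt1 q_bounds rule_centre rule_universal w.
  exists p' => //; apply: inrm_le_coord => i.
  change (side n 1) with (S 1) in hw, hp'.
  move: (corner n q 1 w) hw hp' => o /forallP/(_ i) + /forallP/(_ i).
  by rewrite !mxE; move: (o 0 i) (p 0 i) (p' 0 i) (S 1) => a b c s; lia.
exists (@lattice_set R d Y).
have ex_scale (r : R) : exists k, 2 * r <= (S k)%:R.
  exists (Num.truncn (2 * r)).+1; apply/ltW/(lt_le_trans (truncnS_gt _)).
  by rewrite ler_nat.
(* The least level whose side reaches 2 r. Sufficiency gives repetitivity, minimality bounds the
   preceding side by 2 r for the growth estimate. *)
pose kappa r := ex_minn (ex_scale r).
have kappaP r : 2 * r <= (S (kappa r))%:R by rewrite /kappa; case: ex_minnP.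
have kappa_min r k : 2 * r <= (S k)%:R -> (kappa r <= k)%N.
  by rewrite /kappa; case: ex_minnP => k' _; apply.
pose A : R := 4 * d%:R + 1.
have A_gt0 : 0 < A by rewrite ltr_wpDl // mulr_ge0.
pose rho r : R := A * (S (kappa r).+1)%:R.
have rho_gt0 r : 0 < rho r by rewrite mulr_gt0 // ltr0n.
have rho_rep : repetitivity_function (@lattice_set R d Y) rho.
  split=> [r _|r s r0 rs|r x y r0 Xx]; first exact: rho_gt0.
    rewrite /rho ler_pM2l // ler_nat; apply: S_mono; rewrite ltnS; apply: kappa_min.
    by apply: le_trans (kappaP s); rewrite ler_pM2l.
  apply: (lattice_set_recurrent (side := S) (corner := corner n q) (k := kappa r)) => //.
  - by move=> k p; exact: in_cell.
  - by move=> v w; exact: (colour_recurrence n_gt0 m_gt1 q_bounds rule_centre rule_universal).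
  - exact: S_mono.
split.
- exact: lattice_set_Delone Y_dense.
- move=> /(lattice_set_coarse Y_dense)[L [C [F [G [L1 C0 FG]]]]].
  have [M [pi /(_ C C0)[s0 hs0]]] :=
    @no_coarse_bilipschitz R d i0 i1 L 2^-1 isT L1 (ltac:(lra) : 0 < 2^-1 :> R).
  (* Level [k] must have a dictionary containing patterns of side [M] and cells of side at least
     [s0]; each summand serves one of these demands. *)
  pose x := (dict_size d M + M + s0)%N.
  pose k := (2 ^ x)%N.
  have xk : (x <= level k)%N by rewrite /level trunc_log_max // leqnSn.
  have Mk : (M <= m k)%N by apply: pattern_size_ge; lia.
  have [b hb] := colour_block_cnt n_gt0 m_gt1 q_bounds rule_centre rule_universal pi Mk.
  apply: (hs0 (S k) _ Y F G (cell_cnt n rule k) b FG) => //.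
    apply: leq_trans (S_ge k); apply: (@leq_trans x); first by rewrite leq_addl.
    by apply/ltnW/ltn_expl.
  have sw j : \sum_(i < j) waste R i <= 1 by have := sum_waste R j; lra.
  apply: le_trans (cell_gap n_gt0 rule_generic _ sw k).
    by apply: ler_wpM2r => //; have := sum_waste R k; lra.
  move=> j; apply: le_trans (dict_waste R hd j); rewrite ler_nat.
  by have [] := hrq j.
- by exists rho.
exists rho => // q0 hq0; apply/cvgrPdist_le => eps eps0.
have [j hj] := repetitivity_ratio_small hd A_gt0 hq0 eps0.
near=> r.
have r_big : (S (2 ^ j)%N)%:R < r by near: r; exact: nbhs_pinfty_gt.
have r0 : 0 < r by apply: le_lt_trans r_big.
rewrite sub0r normrN ger0_norm; last first.
  by rewrite divr_ge0 ?(ltW (rho_gt0 r)) ?mulr_ge0 ?powR_ge0 ?(ltW r0).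
(* For large [r] the level [kappa r] exceeds 2^j, so its logarithm reaches [j], and the estimate
   applies with [k] the predecessor of [kappa r]. *)
have kj : (2 ^ j < kappa r)%N.
  rewrite ltnNge; apply/negP => /S_mono; rewrite -(ler_nat R) => h.
  have := le_trans (kappaP r) h; lra.
have kE : kappa r = (kappa r).-1.+1 by rewrite prednK // (leq_ltn_trans _ kj).
rewrite /rho kE; apply: hj; rewrite -?kE.
  by rewrite /level trunc_log_max //; apply/leqW/ltnW.
rewrite ltNge; apply/negP => /kappa_min; rewrite {1}kE ltnn //.
Unshelve. all: by end_near. Qed.
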